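(* Let $\gamma$ be a penalty function satisfying the standing assumptions (A0)–(A3) of the context, and let $f:\Omega\times\mathbb{R}\to(-\infty,\infty]$ be a proper normal convex integrand. Suppose that there exists $\eta_0\in L^{\rho_\gamma}$ with $f^*(\cdot,\eta_0)^+\in L^{\rho_\gamma}$, and that there exists $\xi_0\in L^\infty$ with $f(\cdot,\xi_0)^+\in M^{\rho_\gamma}_u$. Then $$\mathcal{I}_{f,\gamma}^*(\eta)=\mathcal{H}_{f^*,\gamma}(\eta)=\inf_{Q\in\mathcal{Q}_\gamma}\left(\mathcal{H}_{f^*}(\eta|Q)+\gamma(Q)\right),\qquad\forall\eta\in L^1.$$ In particular, $\mathcal{H}_{f^*,\gamma}$ is weakly (i.e. $\sigma(L^1,L^\infty)$-) lower semicontinuous on $L^1$, and $$\mathcal{I}_{f,\gamma}(\xi)=\sup_{\eta\in L^1}\left(\mathbb{E}[\xi\eta]-\mathcal{H}_{f^*,\gamma}(\eta)\right),\qquad\xi\in L^\infty.$$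
   Context: **Probability space.** $(\Omega,\mathcal{F},\mathbb{P})$ is a complete probability space; $L^0$ is the space of ($\mathbb{P}$-a.s. classes of) real random variables and $L^p=L^p(\Omega,\mathcal{F},\mathbb{P})$. ''A.s.'' and identification of random variables always refer to $\mathbb{P}$; $\mathbb{E}$ is $\mathbb{P}$-expectation, $\mathbb{E}_Q$ is $Q$-expectation. $\mathcal{Q}$ is the set of probability measures $Q\ll\mathbb{P}$ on $\mathcal{F}$, identified with $\{\eta\in L^1:\eta\ge0,\ \mathbb{E}[\eta]=1\}$ via $Q\mapsto dQ/d\mathbb{P}$. For $Q\in\mathcal{Q}$, $L^1(Q)=\{\xi\in L^0:\mathbb{E}_Q[|\xi|]<\infty\}$. **Penalty function.** $\gamma:\mathcal{Q}\to[0,\infty]$ satisfies: (A0) $\gamma$ is proper, convex and $\sigma(L^1,L^\infty)$-lower semicontinuous; (A1) $\inf_{Q\in\mathcal{Q}}\gamma(Q)=0$; (A2) there is $Q_0\in\mathcal{Q}$ with $Q_0\sim\mathbb{P}$ and $\gamma(Q_0)<\infty$; (A3) $\{Q\in\mathcal{Q}:\gamma(Q)\le1\}$ is $\sigma(L^1,L^\infty)$-compact. $\mathcal{Q}_\gamma:=\{Q\in\mathcal{Q}:\gamma(Q)<\infty\}$. Set $\rho_\gamma(\xi):=\sup_{Q\in\mathcal{Q}_\gamma}(\mathbb{E}_Q[\xi]-\gamma(Q))$ for $\xi\in L^0$ with $\xi^-\in\bigcap_{Q\in\mathcal{Q}_\gamma}L^1(Q)$, and $$L^{\rho_\gamma}=\{\xi\in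 L^0:\exists\alpha>0,\ \rho_\gamma(\alpha|\xi|)<\infty\},$$ $$M^{\rho_\gamma}_u=\{\xi\in L^0:\forall\alpha>0,\ \lim_{N\to\infty}\rho_\gamma(\alpha|\xi|\mathbf{1}_{\{|\xi|>N\}})=0\}.$$ **Integrand and functionals.** $f$ is a proper normal convex integrand: $f$ is $\mathcal{F}\otimes\mathcal{B}(\mathbb{R})$-measurable and $f(\omega,\cdot)$ is a lower semicontinuous proper convex function for a.e. $\omega$. $f(\cdot,\xi)$ denotes $\omega\mapsto f(\omega,\xi(\omega))$, and $f^*(\omega,y):=\sup_{x\in\mathbb{R}}(xy-f(\omega,x))$. For $\xi\in L^\infty$, $\mathcal{I}_{f,\gamma}(\xi):=\sup_{Q\in\mathcal{Q}_\gamma}(\mathbb{E}_Q[f(\cdot,\xi)]-\gamma(Q))$, and for $\eta\in L^1$ (regarded as an element of $(L^\infty)^*$), $\mathcal{I}_{f,\gamma}^*(\eta):=\sup_{\xi\in L^\infty}(\mathbb{E}[\xi\eta]-\mathcal{I}_{f,\gamma}(\xi))$. With $\mathrm{dom}f(\omega,\cdot)=\{x:f(\omega,x)<\infty\}$, set for $y\in\mathbb{R}$, $z\ge0$ $$\tilde f^*(\omega,y,z):=\sup_{x\in\mathrm{dom}f(\omega,\cdot)}(xy-zf(\omega,x)).$$ For $\eta\in L^1$, $Q\in\mathcal{Q}_\gamma$: $\mathcal{H}_{f^*}(\eta|Q):=\mathbb{E}[\tilde f^*(\cdot,\eta,dQ/d\mathbb{P})]$ and $\mathcal{H}_{f^*,\gamma}(\eta):=\inf_{Q\in\mathcal{Q}_\gamma}(\mathcal{H}_{f^*}(\eta|Q)+\gamma(Q))$.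 *)

(* Defs.v *)
From HB Require Import structures.
From mathcomp Require Import all_boot all_order all_algebra.
From mathcomp Require Import all_classical all_reals all_analysis.
From mathcomp Require Import measurable_realfun.

Set Implicit Arguments.
Unset Strict Implicit.
Unset Printing Implicit Defensive.

Import Order.TTheory GRing.Theory Num.Theory.
Import numFieldNormedType.Exports.

Local Open Scope classical_set_scope.
Local Open Scope ring_scope.
Local Open Scope ereal_scope.
Local Open Scope charge_scope.

(* Random variables are actual functions here: P-a.s. equal functions are not
   identified, but every notion below is invariant under P-a.s. equality of
   measurable functions. *)
Section duality.
Context d (T : measurableType d) (R : realType) (P : probability T R).

Definition L1 := LfunType P (lexx (1 : \bar R)).
Definition Loo := LfunType P (leey (1 : \bar R)).

(* E[xi eta]; finite by Hoelder, so [fine] loses nothing. *)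
Definition pairing (eta : L1) (xi : Loo) : R :=
  fine 'E_P[(xi \* eta)%R].

(* L^1 with sigma(L^1, L^oo), the coarsest topology that makes all the maps
   eta |-> E[xi eta] continuous. *)
Definition weakL1 :=
  initial_topology (pairing : L1 -> prod_topology (fun _ : Loo => R)).

HB.instance Definition _ := Topological.on weakL1.

(* The set of probability measures absolutely continuous w.r.t. P. *)
Record acprob := ACProb {
  acprob_val :> probability T R;
  acprob_dom : acprob_val `<< P }.

HB.instance Definition _ := gen_eqMixin acprob.
HB.instance Definition _ := gen_choiceMixin acprob.

Definition density_fun (Q : acprob) : T -> R :=
  fine \o 'd (charge_of_finite_measure Q) '/d P.

Lemma density_fun_Lfun (Q : acprob) : density_fun Q \in Lfun P 1.
Proof.
apply/Lfun1_integrable.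
have QP : charge_of_finite_measure Q `<< P by exact: acprob_dom.
rewrite (_ : EFin \o _ = 'd (charge_of_finite_measure Q) '/d P).
  exact: Radon_Nikodym_integrable.
by apply/funext => w; rewrite /= fineK// Radon_Nikodym_fin_num.
Qed.

Definition density (Q : acprob) : L1 :=
  Lfun_Sub (lexx (1 : \bar R)) (density_fun_Lfun Q).

(* Q |-> dQ/dP identifies [acprob] with a subset of L^1, which carries the
   topology induced by sigma(L^1, L^oo). *)
HB.instance Definition _ :=
  Topological.copy acprob (initial_topology (density : acprob -> weakL1)).

End duality.

Section penalty.
Context d (T : measurableType d) (R : realType) (P : probability T R).
Implicit Types (gamma : acprob P -> \bar R) (g : T -> \bar R).

(* The mixture t Q1 + (1 - t) Q2 is given by its values on measurable sets. As
   measures are total functions on [set T], with irrelevant values outside of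
   the sigma-algebra, the case t = 1 also says that gamma only depends on the
   values on measurable sets. *)
Definition convex_penalty gamma := forall (Q1 Q2 Q : acprob P) (t : R),
  (0 <= t <= 1)%R ->
  (forall A, measurable A -> Q A = t%:E * Q1 A + (1 - t)%:E * Q2 A) ->
  gamma Q <= t%:E * gamma Q1 + (1 - t)%:E * gamma Q2.

Record penalty gamma : Prop := Penalty {
  penalty_ge0 : forall Q, 0 <= gamma Q;
  penalty_proper : exists Q, gamma Q < +oo;
  penalty_convex : convex_penalty gamma;
  penalty_lsc : lower_semicontinuous gamma;
  penalty_inf0 : ereal_inf (range gamma) = 0;
  penalty_equiv : exists Q0 : acprob P, P `<< Q0 /\ gamma Q0 < +oo;
  penalty_compact : compact [set Q | gamma Q <= 1] }.

Definition fin_penalty gamma : set (acprob P) := [set Q | gamma Q < +oo].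

(* [rho] is only meant for g whose negative part is integrable under every Q in
   [fin_penalty gamma]; it is only applied to nonnegative g below. *)
Definition rho gamma g : \bar R :=
  ereal_sup [set \int[Q]_w g w - gamma Q | Q in fin_penalty gamma].

(* L^0: extended real-valued functions are allowed (as for f( . , xi)) provided
   that they are a.s. finite. *)
Definition L0 : set (T -> \bar R) :=
  [set g : T -> \bar R |
    measurable_fun setT g /\ {ae P, forall w, g w \is a fin_num}].

Definition Lrho gamma : set (T -> \bar R) :=
  [set g : T -> \bar R | L0 g /\
    exists2 a : R, (0 < a)%R & rho gamma (fun w => a%:E * `|g w|) < +oo].

Definition Mrhou gamma : set (T -> \bar R) :=
  [set g : T -> \bar R | L0 g /\ forall a : R, (0 < a)%R ->
    rho gamma (fun w => a%:E * `|g w| *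
                 (\1_[set v : T | ((N%:R)%:E < `|g v|)%E] w)%:E) @[N --> \oo] --> 0].

End penalty.

Section integrand.
Context d (T : measurableType d) (R : realType) (P : probability T R).
Implicit Types (f : T -> R -> \bar R) (gamma : acprob P -> \bar R).

Record normal_convex_integrand (f : T -> R -> \bar R) : Prop := NormalConvexIntegrand {
  integrand_measurable : measurable_fun setT (fun p : T * R => f p.1 p.2);
  integrand_gtNy : forall w x, -oo < f w x;
  integrand_proper : {ae P, forall w, exists x, f w x < +oo};
  integrand_lsc : {ae P, forall w, lower_semicontinuous (f w)};
  integrand_convex : {ae P, forall w, forall (x y t : R), (0 <= t <= 1)%R ->
    f w (t * x + (1 - t) * y)%R <= t%:E * f w x + (1 - t)%:E * f w y} }.

Definition conjugate f (w : T) (y : R) : \bar R :=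
  ereal_sup [set (x * y)%:E - f w x | x in setT].

Definition persp_conjugate f (w : T) (y z : R) : \bar R :=
  ereal_sup [set (x * y)%:E - z%:E * f w x | x in [set x | f w x < +oo]].

Definition Ifun f gamma (xi : Loo P) : \bar R :=
  ereal_sup [set \int[Q]_w f w (xi w) - gamma Q | Q in fin_penalty gamma].

Definition Iconj f gamma (eta : L1 P) : \bar R :=
  ereal_sup [set 'E_P[(xi \* eta)%R] - Ifun f gamma xi | xi in [set: Loo P]].

Definition Hdiv f (eta : L1 P) (Q : acprob P) : \bar R :=
  \int[P]_w persp_conjugate f w (eta w) (density Q w).

Definition Hpen f gamma (eta : L1 P) : \bar R :=
  ereal_inf [set Hdiv f eta Q + gamma Q | Q in fin_penalty gamma].

End integrand.

(* Main.v *)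
From HB Require Import structures.
Require Import Defs.
From mathcomp Require Import all_boot all_order all_algebra.
From mathcomp Require Import all_classical all_reals all_analysis.
From mathcomp Require Import measurable_realfun ess_sup_inf ring lra.

(** Weak duality is pointwise: E[xi eta] - E_Q[f(xi)] <= H(eta|Q) whenever f(xi)
    is Q-integrable and finite P-almost surely. The second condition follows
    from I(xi) < +oo, since some Q0 equivalent to P has finite penalty; it
    matters on the set where dQ/dP vanishes ([Ifun_lty_fval], [Hdiv_ge]).

    The converse is a minimax theorem for the Lagrangian
      L(xi, Q) = E[xi eta] - E_Q[f(xi)] + gamma(Q),
    in which the infimum over Q gives E[xi eta] - I(xi) and the supremum over xi
    gives H(eta|Q) + gamma(Q).
    - The supremum over xi is computed by exchanging it with the integral, and
      it suffices to let xi range over the good functions: bounded, with f(xi)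
      at most f(xi0)^+ plus a constant ([Hdiv_approx]). The pointwise supremum
      that defines the perspective conjugate is reached along countably many
      good functions, made of rational constants and xi0: in a convex domain
      that contains xi0 and another point, rational points are dense
      ([candidate_sup]). Pasting them together approaches the integral of the
      supremum ([interchange_sup]).
    - For good xi, f(xi) is bounded above by a function of M_u up to a constant.
      So f(xi)^+ is uniformly integrable under the Q of a level set of gamma,
      and L(xi, .) is lower semicontinuous there ([lagrangian_lsc]); outside of
      the level sets, L(xi0, .) is large ([lagrangian_coercive]). All levels of
      gamma are compact, by mixing with a probability of small penalty
      ([level_compact]).
    - If a is below the infimum over Q of the supremum over xi, compactness
      gives finitely many xi such that at each Q one of them has L(xi, Q) >= a;
      convexity in Q and concavity in xi merge them into a single one
      ([finite_alternative]).

    Weak lower semicontinuity follows, because I^* is a supremum of weakly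
    continuous functions. For the last formula, fix Q and write f(xi) as the
    biconjugate ([biconjugate], one-dimensional Fenchel-Moreau): the same
    interchange, now over pastings y of rational constants and eta0 and under Q,
    recovers E_Q[f(xi)] from the dual elements y dQ/dP ([dual_attainment]). *)

Set Implicit Arguments.
Unset Strict Implicit.
Unset Printing Implicit Defensive.

Import Order.TTheory GRing.Theory Num.Theory.
Import numFieldNormedType.Exports.

Local Open Scope classical_set_scope.
Local Open Scope ring_scope.
Local Open Scope ereal_scope.

(** * Convex functions of one real variable *)

Section convex_line.
Context {R : realType}.
Implicit Types (h : R -> \bar R) (a b c x y z t : R).

Definition econvex h := forall x y t, (0 <= t <= 1)%R ->
  h (t * x + (1 - t) * y)%R <= t%:E * h x + (1 - t)%:E * h y.

Lemma fin_of_lty h x : (forall u, -oo < h u) -> h x < +oo ->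
  exists r, h x = r%:E.
Proof. by move=> /(_ x); case: (h x) => // r _ _; exists r. Qed.

Lemma ereal_between (v w : \bar R) : v < w -> exists2 a, v < a%:E & a%:E < w.
Proof.
case: v w => [r||] [s||]//=.
- by rewrite lte_fin => rs; exists ((r + s) / 2)%R; rewrite lte_fin; lra.
- by exists (r + 1)%R; rewrite ?ltry// lte_fin; lra.
- by exists (s - 1)%R; rewrite ?ltNyr// lte_fin; lra.
- by exists 0%R; rewrite ?ltNyr ?ltry.
Qed.

(** Moving from x slightly towards x0 preserves the strict inequality, by
    convexity along the segment, and the segment contains rational points
    arbitrarily close to x. *)
Lemma econvex_rat_approx h x0 x y z a : econvex h -> (forall u, -oo < h u) ->
  h x0 < +oo -> h x < +oo -> (0 <= z)%R -> x != x0 ->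
  a%:E < (x * y)%:E - z%:E * h x ->
  exists q : rat, h (ratr q) < +oo /\
    a%:E < (ratr q * y)%:E - z%:E * h (ratr q).
Proof.
move=> cvxh hNy /fin_of_lty[//|b0 hb0] /fin_of_lty[//|b hb] z0 xx0.
rewrite hb -EFinM -EFinB lte_fin => ltab.
pose K := ((x0 - x) * y - z * (b0 - b))%R.
pose e := (x * y - z * b - a)%R.
have e0 : (0 < e)%R by rewrite /e; lra.
pose s0 := Num.min 1%R (e / (`|K| + 1))%R.
have K1 : (0 < `|K| + 1)%R by rewrite ltr_wpDl.
have s00 : (0 < s0)%R by rewrite lt_min ltr01 divr_gt0.
have sK s : (0 < s < s0)%R -> (0 < e + s * K)%R.
  move=> /andP[s_gt0]; rewrite lt_min => /andP[_].
  rewrite ltr_pdivlMr// => ses.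
  have : (- (s * K) <= s * `|K|)%R.
    by rewrite -mulrN; apply: ler_wpM2l (ltW s_gt0) _ _ _; rewrite -normrN ler_norm.
  by lra.
have s01 : (s0 <= 1)%R by rewrite ge_min lexx.
have [q [s [s_gt0 ss0 qE]]] : exists q : rat, exists s : R,
    [/\ (0 < s)%R, (s < s0)%R & ratr q = (x + s * (x0 - x))%R].
  have d0 : (x0 - x != 0)%R by rewrite subr_eq0 eq_sym.
  have [xlt|xgt] := ltP x x0.
    have xs : (x < x + s0 * (x0 - x))%R by rewrite ltrDl mulr_gt0// subr_gt0.
    have [q] := rat_in_itvoo xs; rewrite in_itv/= => /andP[q1 q2].
    exists q, ((ratr q - x) / (x0 - x))%R; split.
    - by rewrite divr_gt0 ?subr_gt0.
    - by rewrite ltr_pdivrMr ?subr_gt0//; lra.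
    - by rewrite divfK//; lra.
  have {}xgt : (x0 < x)%R by rewrite lt_neqAle eq_sym xx0.
  have xs : (x + s0 * (x0 - x) < x)%R by rewrite gtrDl pmulr_rlt0// subr_lt0.
  have [q] := rat_in_itvoo xs; rewrite in_itv/= => /andP[q1 q2].
  exists q, ((ratr q - x) / (x0 - x))%R; split.
  - by rewrite -mulrNN -invrN divr_gt0// ?oppr_gt0 ?subr_lt0.
  - rewrite -mulrNN -invrN ltr_pdivrMr ?oppr_gt0 ?subr_lt0//; lra.
  - by rewrite divfK//; lra.
have hq : h (ratr q) <= ((1 - s) * b + s * b0)%:E.
  have := cvxh x x0 (1 - s)%R.
  have -> : ((1 - s) * x + (1 - (1 - s)) * x0 = ratr q)%R by rewrite qE; ring.
  rewrite hb hb0 -!EFinM -EFinD subKr; apply.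
  by apply/andP; split; lra.
exists q; split; first by rewrite (le_lt_trans hq)// ltry.
have [r hr] := fin_of_lty hNy (le_lt_trans hq (ltry _)).
move: hq; rewrite hr lee_fin -EFinM -EFinB lte_fin => hq.
have : (z * r <= z * ((1 - s) * b + s * b0))%R by rewrite ler_wpM2l.
have : (0 < e + s * K)%R by apply: sK; rewrite s_gt0.
by rewrite /e /K qE; nra.
Qed.

(** A line through (x, a) stays below h when its slope lies between those of the
    chords to points of the graph on the left and on the right of x. Convexity
    orders the two families of slopes; the given minorant bounds them, so that a
    real slope exists even when one of the families is empty. *)
Lemma econvex_minorant h x a b c : econvex h -> (forall u, -oo < h u) ->
  lower_semicontinuous h -> (forall u, (c * u - b)%:E <= h u) -> a%:E < h x ->
  exists y, forall u, (a + y * (u - x))%:E <= h u.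
Proof.
move=> cvxh hNy lsch hmin ax.
have [V xV Va] := lsch _ _ ax.
have [e /= e0 eV] := (nbhs_ballP _ _).1 xV.
pose B := (`|c| + `|a + b - c * x| / e)%R.
have B0 : (0 <= B)%R by rewrite addr_ge0// divr_ge0// ltW.
have near_gt u r : h u = r%:E -> (`|u - x| < e)%R -> (a < r)%R.
  by move=> hu ux; rewrite -lte_fin -hu; apply/Va/eV; rewrite /ball/= distrC.
(* near x the graph lies above a, and farther than e the minorant limits how
   steeply the graph can go below a *)
have steep u r : h u = r%:E -> (a - r <= B * `|u - x|)%R.
  move=> hu; have [/(near_gt _ _ hu)|ue] := ltP `|u - x|%R e.
    by have := mulr_ge0 B0 (normr_ge0 (u - x)%R); lra.
  have := hmin u; rewrite hu lee_fin => ru.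
  have h1 : (`|a + b - c * x| <= `|a + b - c * x| / e * `|u - x|)%R.
    by rewrite -mulrA ler_peMr// ler_pdivlMl// mulr1.
  have h2 : (- (c * (u - x)) <= `|c| * `|u - x|)%R.
    by rewrite -normrM -normrN ler_norm.
  have := ler_norm (a + b - c * x)%R.
  by rewrite /B mulrDl; lra.
pose L := [set l : R | l = (- B)%R \/
  exists u r, [/\ (u < x)%R, h u = r%:E & l = ((a - r) / (x - u))%R]].
have L0 : L !=set0 by exists (- B)%R; left.
have cross v s : (x < v)%R -> h v = s%:E -> ubound L ((s - a) / (v - x))%R.
  move=> xv hv l [->|[u [r [ux hu ->]]]].
    have := steep _ _ hv; rewrite gtr0_norm ?subr_gt0// => st.
    by rewrite ler_pdivlMr ?subr_gt0//; lra.
  rewrite ler_pdivlMr ?subr_gt0// mulrAC ler_pdivrMr ?subr_gt0//.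
  have vu : (0 < v - u)%R by lra.
  pose t := ((v - x) / (v - u))%R.
  have t01 : (0 <= t <= 1)%R.
    by rewrite /t divr_ge0/= ?ler_pdivrMr//; lra.
  have := cvxh u v t t01.
  have -> : (t * u + (1 - t) * v = x)%R.
    by rewrite /t; field; rewrite gt_eqF.
  rewrite hu hv -!EFinM -EFinD => /(lt_le_trans ax); rewrite lte_fin.
  rewrite -(ltr_pM2r vu) mulrDl.
  have -> : (t * r * (v - u) = (v - x) * r)%R by rewrite /t; field; rewrite gt_eqF.
  have -> : ((1 - t) * s * (v - u) = (x - u) * s)%R by rewrite /t; field; rewrite gt_eqF.
  by lra.
have LB : ubound L B.
  move=> l [->|[u [r [ux hu ->]]]]; first by rewrite ge0_cp.
  have := steep _ _ hu; rewrite ltr0_norm ?subr_lt0// opprB => st.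
  by rewrite ler_pdivrMr ?subr_gt0.
have supL : has_sup L by split => //; exists B.
exists (sup L) => u.
case hu : (h u) => [r||]; last 2 first.
- by rewrite leey.
- by have := hNy u; rewrite hu.
rewrite lee_fin; have [ux|xu|ux] := ltgtP u x.
- have : L ((a - r) / (x - u))%R by right; exists u, r.
  move=> /(sup_upper_bound supL); rewrite ler_pdivrMr ?subr_gt0//.
  by lra.
- have := ge_sup L0 (cross _ _ xu hu).
  by rewrite ler_pdivlMr ?subr_gt0//; lra.
- by rewrite ux subrr mulr0 addr0 -lee_fin -hu ux ltW.
Qed.

End convex_line.

(** * Minimax for finitely many functions *)

Section finite_minimax.
Local Open Scope ring_scope.
Context {R : realType} {U : Type} {V : eqType}.

(** Fan's notions of convexity, which ask for no linear structure: mixtures of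
    probabilities are only determined on measurable sets. *)
Definition convexlike (X : set U) (W : set V) (l : V -> U -> R) :=
  forall x y t, X x -> X y -> 0 <= t <= 1 ->
    exists2 z, X z & forall v, W v -> l v z <= t * l v x + (1 - t) * l v y.

Definition concavelike (X : set U) (W : set V) (l : V -> U -> R) :=
  forall v w t, W v -> W w -> 0 <= t <= 1 ->
    exists2 s, W s & forall x, X x -> t * l v x + (1 - t) * l w x <= l s x.

(** Each point where one of the functions is below a bounds the weight from one
    side. A lower bound given by y and an upper bound given by x are compatible:
    otherwise a mixture of x and y would bring both functions below a. *)
Lemma two_function_alternative (X : set U) (W : set V) l v w a :
  convexlike X W l -> W v -> W w ->
  (forall x, X x -> a <= l v x \/ a <= l w x) ->
  exists2 t, 0 <= t <= 1 &
    forall x, X x -> a <= t * l v x + (1 - t) * l w x.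
Proof.
move=> cvxl Wv Ww vw.
(* the least weight of v at a point where w alone fails *)
pose low y := (a - l w y) / (l v y - l w y).
pose L := [set s | s = 0 \/ exists y, [/\ X y, l w y < a & s = low y]].
have low01 y : X y -> l w y < a -> low y <= 1.
  move=> Xy wy; have [|] := vw _ Xy; last by lra.
  by move=> vy; rewrite /low ler_pdivrMr; lra.
have cross x : X x -> l v x < a ->
    ubound L ((l w x - a) / (l w x - l v x)).
  move=> Xx vx s.
  have wx : a <= l w x by have [|//] := vw _ Xx; lra.
  move=> [->|[y [Xy wy ->]]]; first by rewrite divr_ge0; lra.
  have vy : a <= l v y by have [//|] := vw _ Xy; lra.
  have wvx : 0 < l w x - l v x by lra.
  rewrite /low ler_pdivlMr// mulrAC ler_pdivrMr; last by lra.
  suff : (l v y - a) * (l w x - a) >= (a - l v x) * (a - l w y) by nra.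
  rewrite leNgt; apply/negP => lt0.
  pose p := a - l v x; pose q := l v y - a.
  pose r := a - l w y; pose k := l w x - a.
  (* as p r > q k, giving x the weight q + r and y the weight p + k brings both
     functions below a *)
  have N0 : 0 < p + q + r + k by rewrite /p /q /r /k; lra.
  pose t := (q + r) / (p + q + r + k).
  have t01 : 0 <= t <= 1.
    by rewrite /t divr_ge0/= ?ler_pdivrMr//= /p /q /r /k; lra.
  have [z Xz zl] := cvxl x y t Xx Xy t01.
  have E g : t * g * (p + q + r + k) = (q + r) * g.
    by rewrite /t; field; rewrite gt_eqF.
  have E' g : (1 - t) * g * (p + q + r + k) = (p + k) * g.
    by rewrite /t; field; rewrite gt_eqF.
  have vz := zl v Wv; have wz := zl w Ww.
  have : l v z < a.
    rewrite (le_lt_trans vz)// -(ltr_pM2r N0) mulrDl E E'.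
    by move: lt0; rewrite /p /q /r /k; nra.
  have : l w z < a.
    rewrite (le_lt_trans wz)// -(ltr_pM2r N0) mulrDl E E'.
    by move: lt0; rewrite /p /q /r /k; nra.
  by have [] := vw _ Xz; lra.
have L0 : L 0 by left.
have LB : ubound L 1.
  by move=> s [->|[y [Xy wy ->]]]; [exact: ler01|exact: low01].
have supL : has_sup L by split; [exists 0|exists 1].
exists (sup L).
  by rewrite (sup_upper_bound supL)//= ge_sup//; exists 0.
move=> x Xx; have [vx|vx] := ltP (l v x) a.
  have wx : a <= l w x by have [|//] := vw _ Xx; lra.
  have := ge_sup (ex_intro _ _ L0) (cross _ Xx vx).
  by rewrite ler_pdivlMr; nra.
have [wx|wx] := ltP (l w x) a.
  have : L (low x) by right; exists x.
  move=> /(sup_upper_bound supL).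
  by rewrite /low ler_pdivrMr; nra.
have := sup_upper_bound supL L0.
have := ge_sup (ex_intro _ _ L0) LB.
by nra.
Qed.

(** By induction, the functions other than v0 are merged into one that is at
    least a wherever v0 is below a; this one is then merged with v0. *)
Lemma finite_alternative (X : set U) (W : set V) l v0 (vs : seq V) a :
  convexlike X W l -> concavelike X W l -> W v0 ->
  (forall v, v \in vs -> W v) ->
  (forall x, X x -> exists2 v, v \in v0 :: vs & a <= l v x) ->
  exists2 v, W v & forall x, X x -> a <= l v x.
Proof.
elim: vs X v0 => [|v1 vs IH] X v0 cvxl ccvl W0 Ws cover.
  by exists v0 => // x /cover[v]; rewrite inE => /eqP ->.
(* the points where v0 fails form a convexlike set again *)
pose X' := X `&` [set x | l v0 x < a].
have [|||||v Wv vX'] := IH X' v1.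
- move=> x y t [Xx /= x0] [Xy /= y0] t01.
  have [z Xz zl] := cvxl x y t Xx Xy t01.
  exists z => //; split => //=.
  have ma : Num.max (l v0 x) (l v0 y) < a by rewrite gt_max x0.
  rewrite (le_lt_trans (zl _ W0))// (le_lt_trans _ ma)//.
  have xm : l v0 x <= Num.max (l v0 x) (l v0 y) by rewrite le_max lexx.
  have ym : l v0 y <= Num.max (l v0 x) (l v0 y) by rewrite le_max lexx orbT.
  by move: t01 => /andP[]; nra.
- move=> v w t Wv Ww t01; have [s Wss sl] := ccvl v w t Wv Ww t01.
  by exists s => // x [Xx _]; exact: sl.
- by apply: Ws; rewrite mem_head.
- by move=> v vvs; apply: Ws; rewrite inE vvs orbT.
- move=> x [Xx /= x0]; have [v] := cover _ Xx; rewrite inE => /orP[/eqP ->|vvs] vx.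
    by move: vx; rewrite leNgt x0.
  by exists v.
have [|t t01 tP] := @two_function_alternative X W l v0 v a cvxl W0 Wv.
  by move=> x Xx; case: (leP a (l v0 x)) => ?; [left|right; apply: vX'; split].
have [s Wss sl] := ccvl v0 v t W0 Wv t01.
by exists s => // x Xx; apply: le_trans (tP _ Xx) (sl _ Xx).
Qed.

End finite_minimax.

(** * Integration and pointwise suprema *)

Section integration.
Context d (T : measurableType d) (R : realType).
Implicit Types (mu : {measure set T -> \bar R}) (g h : T -> R).

Local Notation "mu '.-rint' g" := (mu.-integrable setT (EFin \o g))
  (at level 2).

Lemma ae_integrableP mu (g h : T -> R) : measurable_fun setT g ->
  {ae mu, forall w, `|g w| <= h w}%R -> mu.-rint h -> mu.-rint g.
Proof.
move=> mg gh ih; apply/integrableP; split; first exact/measurable_EFinP.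
have /integrableP[mh hoo] := ih.
apply: le_lt_trans hoo; apply: ae_ge0_le_integral => //.
- by apply: measurableT_comp => //; exact/measurable_EFinP.
- by apply: measurableT_comp => //.
- apply: filterS gh => w gh _ /=; rewrite lee_fin.
  by rewrite (le_trans gh)// ler_norm.
Qed.

Lemma ae_le_integral mu (s v : T -> \bar R) : measurable_fun setT s ->
  measurable_fun setT v -> {ae mu, forall w, s w <= v w} ->
  \int[mu]_w s w <= \int[mu]_w v w.
Proof.
move=> ms mv sv; rewrite integralE [leRHS]integralE.
apply: leeB.
  apply: ae_ge0_le_integral => //; try exact: measurable_funepos.
  by apply: filterS sv => w sv _; rewrite !funeposE le_max2.
apply: ae_ge0_le_integral => //; try exact: measurable_funeneg.
by apply: filterS sv => w sv _; rewrite !funenegE le_max2// leeN2.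
Qed.

Lemma integrable_of_minorant mu (g : T -> R) (s : T -> \bar R) :
  mu.-rint g -> measurable_fun setT s -> {ae mu, forall w, (g w)%:E <= s w} ->
  \int[mu]_w s w < +oo -> mu.-integrable setT s.
Proof.
move=> ig ms gs soo.
have neg : \int[mu]_w s^\- w < +oo.
  apply: (@le_lt_trans _ _ (\int[mu]_w (EFin \o g)^\- w)); last first.
    by apply: integral_funeneg_lt_pinfty ig.
  apply: ae_ge0_le_integral => //; try exact: measurable_funeneg.
    by apply: measurable_funeneg; exact: measurable_int ig.
  by apply: filterS gs => w gs _; rewrite !funenegE le_max2// leeN2.
have negfin : \int[mu]_w s^\- w \is a fin_num.
  by rewrite ge0_fin_numE// integral_ge0.
have pos : \int[mu]_w s^\+ w < +oo.
  move: soo; rewrite integralE.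
  rewrite -[X in _ - X](fineK negfin); case: (integral _ _ s^\+) => [r||]//=.
  by rewrite !ltry.
apply/integrableP; split => //.
have -> : (fun w => `|s w|) = s^\+ \+ s^\- by rewrite -fune_abse.
have ms1 := measurable_funepos ms; have ms2 := measurable_funeneg ms.
by rewrite ge0_integralD// lte_add_pinfty.
Qed.

(** The case where s has infinite integral is what the suprema below require;
    then the right-hand side is +oo. *)
Lemma integral_addr_le mu (s : T -> \bar R) (g : T -> R) :
  measurable_fun setT s -> (forall w, 0 <= s w) -> mu.-rint g ->
  \int[mu]_w (s w + (g w)%:E) <= \int[mu]_w s w + \int[mu]_w (g w)%:E.
Proof.
move=> ms s0 ig; have gfin := integrable_fin_num measurableT ig.
have [soo|] := ltP (\int[mu]_w s w) +oo; last first.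
  by rewrite leye_eq => /eqP ->; rewrite addye ?leey// gt_eqF// ltNye_eq gfin.
rewrite integralD//; apply/integrableP; split => //.
by under eq_integral do rewrite gee0_abs//.
Qed.

(** Pasting the c n so as to take at each point the best of the first n of them
    gives functions in D with nondecreasing values of V, to which monotone
    convergence applies once V along c 0 is subtracted. *)
Lemma interchange_sup mu (V : T -> R -> R) (D : set (T -> R))
    (c : nat -> T -> R) (S : T -> \bar R) (a : \bar R) :
  (forall u v (b : T -> bool), measurable_fun setT b -> D u -> D v ->
     D (fun w => if b w then u w else v w)) ->
  (forall n, D (c n)) ->
  (forall u, D u -> mu.-rint (fun w => V w (u w))) ->
  measurable_fun setT S ->
  {ae mu, forall w, S w = ereal_sup (range (fun n => (V w (c n w))%:E))} ->
  a < \int[mu]_w S w ->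
  exists2 u, D u & a < \int[mu]_w (V w (u w))%:E.
Proof.
move=> Dpaste Dc DV mS SE aS.
have mV u : D u -> measurable_fun setT (fun w => V w (u w)).
  by move=> /DV/integrableP[/measurable_EFinP].
pose z := fix z n := if n is m.+1 then
   (fun w => if (V w (z m w) < V w (c m w))%R then c m w else z m w)
  else c 0%N.
have Dz n : D (z n).
  elim: n => [|n IH] /=; first exact: Dc.
  by apply: Dpaste => //; apply: measurable_fun_ltr; exact: mV.
have zS n w : V w (z n.+1 w) = Num.max (V w (z n w)) (V w (c n w)).
  by rewrite /= maxEle; case: ltgtP => // ->.
(* the running maxima increase and have the same supremum as the V w (c n w) *)
have znd w : nondecreasing_seq (fun n => V w (z n w)).
  by apply/nondecreasing_seqP => n; rewrite zS le_max lexx.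
have zc n w : (V w (c n w) <= V w (z n.+1 w))%R by rewrite zS le_max lexx orbT.
have cz n w : exists m, V w (z n w) = V w (c m w).
  elim: n => [|n [m IH]]; first by exists 0%N.
  by rewrite zS maxEle; case: ifP => _; [exists n|exists m].
pose g n w := (V w (z n w) - V w (c 0%N w))%:E.
have g0 n w : 0 <= g n w by rewrite lee_fin subr_ge0 (znd w 0%N n).
have mg n : measurable_fun setT (g n).
  by apply/measurable_EFinP/measurable_funB; exact: mV.
have gnd w : {homo g^~ w : n m / (n <= m)%N >-> n <= m}.
  by move=> n m nm; rewrite lee_fin lerB// (znd w n m).
pose s w := limn (g^~ w).
have sE w : s w = ereal_sup (range (g^~ w)).
  by apply/cvg_lim => //; apply: ereal_nondecreasing_cvgn; exact: gnd.
have ms : measurable_fun setT s.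
  apply: (emeasurable_fun_cvg g) => // w _.
  by rewrite /s; apply/cvg_ex; eexists; apply: ereal_nondecreasing_cvgn; exact: gnd.
have s0 w : 0 <= s w.
  by rewrite sE (le_trans (g0 0%N w))//; apply: ereal_sup_ubound; exists 0%N.
have iV0 := DV _ (Dc 0%N).
have SsV : \int[mu]_w S w <= \int[mu]_w s w + \int[mu]_w (V w (c 0%N w))%:E.
  rewrite (le_trans _ (integral_addr_le ms s0 iV0))//.
  rewrite le_eqVlt; apply/orP; left; apply/eqP.
  apply: ae_eq_integral => //.
    by apply: emeasurable_funD => //; exact: measurable_int iV0.
  apply: filterS SE => w SE _; rewrite SE; apply/eqP; rewrite eq_le.
  apply/andP; split.
    apply: ge_ereal_sup => _ [n _ <-]; rewrite -leeBlDr// sE.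
    apply: (@le_trans _ _ (g n.+1 w)); first by rewrite /g lee_fin lerB.
    by apply: ereal_sup_ubound; exists n.+1.
  rewrite -leeBrDr// sE; apply: ge_ereal_sup => _ [n _ <-].
  rewrite leeBrDr// /g -EFinD subrK; have [m ->] := cz n w.
  by apply: ereal_sup_ubound; exists m.
have [//|noz] := pselect (exists2 u, D u & a < \int[mu]_w (V w (u w))%:E).
have cfin := integrable_fin_num measurableT iV0.
suff : \int[mu]_w S w <= a by rewrite leNgt aS.
rewrite (le_trans SsV)// -leeBrDr// monotone_convergence//.
apply: lime_le.
  apply: ereal_nondecreasing_is_cvgn => n m nm.
  by apply: ge0_le_integral => // w _; exact: gnd.
apply: nearW => n; rewrite leeBrDr// /g.
under eq_integral do rewrite EFinB.
rewrite integralB//; last exact: DV.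
rewrite subeK// leNgt; apply/negP => an.
by apply: noz; exists (z n).
Qed.

End integration.

(** * Probabilities absolutely continuous with respect to P *)

Section probability_of_measure.
Context d (T : measurableType d) (R : realType).
Context (m : {measure set T -> \bar R}) (m1 : m setT = 1).

(** The proof m1 is an argument so that the probability structure of this
    function can be inferred from its expression. *)
Definition probability_of_measure of m setT = 1 : set T -> \bar R := m.

HB.instance Definition _ := Measure.on (probability_of_measure m1).
HB.instance Definition _ :=
  Measure_isProbability.Build d T R (probability_of_measure m1) m1.

End probability_of_measure.

Section ac_probabilities.
Local Open Scope charge_scope.
Context d (T : measurableType d) (R : realType) (P : probability T R).
Implicit Types (Q : acprob P) (g : T -> R) (xi : Loo P) (eta : L1 P).

Lemma acprob_null Q A : measurable A -> P A = 0 -> Q A = 0.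
Proof.
move=> mA PA; apply: (@acprob_dom _ _ _ _ Q A) => //.
by move=> B mB BA; exact: (subset_measure0 _ _ BA).
Qed.

Lemma acprob_ae Q (A : set T) : {ae P, forall w, A w} -> {ae Q, forall w, A w}.
Proof. by move=> [N [mN N0 AN]]; exists N; split => //; exact: acprob_null. Qed.

Lemma acprob_of_measure (m : {measure set T -> \bar R}) :
  m setT = 1 -> (forall A, measurable A -> P A = 0 -> m A = 0) ->
  exists Q : acprob P, forall A, Q A = m A.
Proof.
move=> m1 mP.
pose Q : probability T R := probability_of_measure m1.
have QP : Q `<< P.
  move=> N NP A mA AN; apply: mP => //; exact: NP.
by exists (ACProb QP).
Qed.

Lemma mixture_integral (m m1 m2 : {measure set T -> \bar R}) (t : R) g :
  (0 <= t <= 1)%R ->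
  (forall A, measurable A -> m A = t%:E * m1 A + (1 - t)%:E * m2 A) ->
  m1.-integrable setT (EFin \o g) -> m2.-integrable setT (EFin \o g) ->
  m.-integrable setT (EFin \o g) /\
  (\int[m]_w g w = t * \int[m1]_w g w + (1 - t) * \int[m2]_w g w)%R.
Proof.
move=> /andP[t0 t1] mE i1 i2.
have t1' : (0 <= 1 - t)%R by rewrite subr_ge0.
pose m' := measure_add (mscale (NngNum t0) m1) (mscale (NngNum t1') m2).
have intE h : (forall w, 0 <= h w) -> measurable_fun setT h ->
    \int[m]_w h w = t%:E * \int[m1]_w h w + (1 - t)%:E * \int[m2]_w h w.
  move=> h0 mh; rewrite (eq_measure_integral m'); last first.
    by move=> A mA _; rewrite mE//; exact/esym/measure_addE.
  by rewrite ge0_integral_measure_add// !ge0_integral_mscale.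
have /integrableP[mg goo1] := i1; have /integrableP[_ goo2] := i2.
have fin_eq s1 s2 : s1 \is a fin_num -> s2 \is a fin_num ->
    t%:E * s1 + (1 - t)%:E * s2 \is a fin_num.
  by move=> f1 f2; rewrite fin_numD !fin_numM.
split.
  apply/integrableP; split => //.
  rewrite intE//; last exact: measurableT_comp.
  by rewrite ltey_eq fin_eq// ge0_fin_numE// integral_ge0.
rewrite /Rintegral integralE !intE//; try exact: measurable_funepos;
  try exact: measurable_funeneg.
have p1 := integrable_pos_fin_num measurableT i1.
have p2 := integrable_pos_fin_num measurableT i2.
have n1 := integrable_neg_fin_num measurableT i1.
have n2 := integrable_neg_fin_num measurableT i2.
rewrite [in RHS]integralE [in X in (_ + _ * X)%R]integralE.
rewrite -(fineK p1) -(fineK p2) -(fineK n1) -(fineK n2) -!EFinM -!EFinD/=.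
by ring.
Qed.

Lemma acprob_mixture Q1 Q2 (t : R) : (0 <= t <= 1)%R -> exists Q,
  forall A, measurable A -> Q A = t%:E * Q1 A + (1 - t)%:E * Q2 A.
Proof.
move=> /andP[t0 t1]; have t1' : (0 <= 1 - t)%R by rewrite subr_ge0.
pose m := measure_add (mscale (NngNum t0) Q1) (mscale (NngNum t1') Q2).
have mE (A : set T) : m A = t%:E * Q1 A + (1 - t)%:E * Q2 A.
  exact: measure_addE.
have [||Q QE] := @acprob_of_measure m.
- by rewrite -[LHS]/(m setT) mE !probability_setT !mule1 -EFinD addrC subrK.
- by move=> A mA PA; rewrite -[LHS]/(m A) mE !acprob_null// !mule0 adde0.
- by exists Q => A mA; rewrite QE; exact: mE.
Qed.

Lemma Loo_ae_bounded xi : exists2 k : R, (0 <= k)%R &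
  {ae P, forall w, (`|xi w| <= k)%R}.
Proof.
have : finite_norm P +oo xi by exact: Lfunction_finite.
rewrite /finite_norm unlock/= probability_setT lte01 => h.
have [k kP] := @ess_supr_bounded _ _ _ P (fun w => `|xi w|)%R h.
exists (Num.max k 0)%R; first by rewrite le_max lexx orbT.
by apply: filterS kP => w wk; rewrite le_max wk.
Qed.

Lemma Loo_of g (k : R) : measurable_fun setT g ->
  {ae P, forall w, `|g w| <= k}%R -> exists xi, xi = g :> (T -> R).
Proof.
move=> mg gk.
have gL : g \in Lfun P +oo.
  rewrite inE; apply/andP; split; rewrite inE//=.
  rewrite /finite_norm unlock/= probability_setT lte01.
  by rewrite (le_lt_trans _ (ltry k))//; apply/ess_supP; apply: filterS gk.
by exists (Lfun_Sub (leey (1 : \bar R)) gL).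
Qed.

Lemma Loo_integrable Q xi : Q.-integrable setT (EFin \o xi).
Proof.
have [k k0 xik] := Loo_ae_bounded xi.
apply: (ae_integrableP _ (acprob_ae Q xik)) => //.
exact: finite_measure_integrable_cst.
Qed.

Lemma density_ge0 Q : {ae P, forall w, (0 <= density Q w)%R}.
Proof.
have QP : Q `<< P := @acprob_dom _ _ _ _ Q.
have := ae_eq_Radon_Nikodym_SigmaFinite QP measurableT.
apply: filterS => w /(_ I) E; rewrite /density/= /density_fun/= -E.
by rewrite fine_ge0// Radon_Nikodym_SigmaFinite.f_ge0.
Qed.

Lemma density_integrable Q g : Q.-integrable setT (EFin \o g) ->
  P.-integrable setT (EFin \o (fun w => g w * density Q w)%R) /\
  \int[P]_w (g w * density Q w)%:E = \int[Q]_w (g w)%:E.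
Proof.
move=> ig; have QP : Q `<< P := @acprob_dom _ _ _ _ Q.
have dE w : (density Q w)%:E = ('d (charge_of_finite_measure Q) '/d P) w.
  by rewrite /density/= /density_fun/= fineK// Radon_Nikodym_fin_num.
have mg : measurable_fun setT g by move: ig => /integrableP[/measurable_EFinP].
have mgd : measurable_fun setT (fun w => g w * density Q w)%R.
  by apply: measurable_funM.
have chvar h : Q.-integrable setT (EFin \o h) ->
    \int[P]_w (h w * density Q w)%:E = \int[Q]_w (h w)%:E.
  move=> ih; rewrite -(Radon_Nikodym_change_of_variables QP)//.
  by apply: eq_integral => w _; rewrite EFinM dE.
split; last exact: chvar.
apply/integrableP; split; first exact/measurable_EFinP.
have ig' := integrable_norm ig.
rewrite (_ : integral _ _ _ = \int[Q]_w (`|g w|)%:E); last first.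
  rewrite -(chvar (fun w => `|g w|)%R)//.
  apply: ae_eq_integral => //.
  - by apply: measurableT_comp => //; exact/measurable_EFinP.
  - apply/measurable_EFinP/measurable_funM => //.
    exact: measurableT_comp.
  - by apply: filterS (density_ge0 Q) => w d0 _; rewrite /= normrM (ger0_norm d0).
by rewrite (integrable_lty _ ig').
Qed.

End ac_probabilities.

(** * The weak topology and the levels of the penalty *)

Section weak_topology_of_probabilities.
Context d (T : measurableType d) (R : realType) (P : probability T R).
Implicit Types (Q : acprob P) (xi : Loo P) (eta : L1 P).

Lemma expectation_Loo_L1 xi eta :
  P.-integrable setT (EFin \o (fun w => xi w * eta w)%R) /\
  'E_P[(xi \* eta)%R] = (\int[P]_w (xi w * eta w))%R%:E.
Proof.
have ieta : P.-integrable setT (EFin \o eta) by apply/Lfun1_integrable/LfunP.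
suff i : P.-integrable setT (EFin \o (fun w => xi w * eta w)%R).
  by split=> //; rewrite unlock /Rintegral fineK// integrable_fin_num.
have [k k0 xik] := Loo_ae_bounded xi.
apply: (@ae_integrableP _ _ _ _ _ (fun w => k * `|eta w|)%R).
- exact: measurable_funM.
- by apply: filterS xik => w xik; rewrite normrM ler_wpM2r.
- rewrite (_ : _ \o _ = (fun w => k%:E * (EFin \o (fun w => `|eta w|%R)) w)).
    by apply: integrableZl => //; exact: integrable_norm.
  by apply/funext => w; rewrite /= EFinM.
Qed.

Lemma pairing_density Q xi : pairing (density Q) xi = (\int[Q]_w xi w)%R.
Proof.
have [_ E] := density_integrable (Loo_integrable Q xi).
have [_ EP] := expectation_Loo_L1 xi (density Q).
by rewrite /pairing EP [in RHS]/Rintegral -E.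
Qed.

Lemma pairing_continuous xi : continuous (fun eta : weakL1 P => pairing eta xi).
Proof.
have cp : continuous
    (pairing (P := P) : weakL1 P -> prod_topology (fun _ : Loo P => R)).
  exact: initial_continuous.
move=> eta; rewrite (_ : (fun _ => _) =
  (proj xi : prod_topology (fun _ : Loo P => R) -> R) \o
  (pairing (P := P) : weakL1 P -> prod_topology (fun _ : Loo P => R)))//.
apply: continuous_comp; first exact: cp.
exact: (@proj_continuous (Loo P) (fun=> R) xi).
Qed.

Lemma Loo_integral_continuous xi :
  continuous (fun Q : acprob P => \int[Q]_w xi w)%R.
Proof.
have cd : continuous (density (P := P) : acprob P -> weakL1 P).
  exact: initial_continuous.
move=> Q; rewrite (_ : (fun _ => _) =
    (fun eta : weakL1 P => pairing eta xi) \o density (P := P)); last first.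
  by apply/funext => Q'; exact/esym/pairing_density.
apply: (@continuous_comp _ (weakL1 P)); first exact: cd.
exact: pairing_continuous.
Qed.

(** The topology of probabilities is initial for the integrals of essentially
    bounded functions, as E[xi dQ/dP] = E_Q[xi]. *)
Lemma acprob_cvgP (F : set_system (acprob P)) Q : Filter F ->
  (forall xi, (fun Q' : acprob P => \int[Q']_w xi w)%R @ F -->
    (\int[Q]_w xi w)%R) -> F --> Q.
Proof.
move=> FF FQ A [_ [[_ [B Bop <-] <-] BQ BA]]; apply: filterS BA _.
pose e Q : prod_topology (fun _ : Loo P => R) := pairing (density Q).
suff : e @ F --> e Q by apply; apply: open_nbhs_nbhs.
apply/cvg_sup => xi; apply/cvg_image.
  by rewrite eqEsubset; split=> // r _; exists (fun=> r).
move=> V; rewrite /= /e pairing_density => /FQ FV.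
exists [set g | V (g xi)].
  have {}FV : F [set Q' | V (\int[Q']_w xi w)%R] by exact: FV.
  rewrite /= nbhs_filterE /fmap/=; apply: filterS FV => Q' /=.
  by rewrite /e pairing_density.
rewrite eqEsubset; split => [r [g Vg <-]//|r Vr].
by exists (fun=> r).
Qed.

End weak_topology_of_probabilities.

Lemma fmap_ultra (S U : Type) (h : S -> U) (F : set_system S) :
  UltraFilter F -> UltraFilter (h @ F).
Proof.
move=> FU; split; first exact: fmap_proper_filter.
move=> G PG FG; rewrite eqEsubset; split => // A GA.
have [//|FnA] := in_ultra_setVsetC (h @^-1` A) FU.
have GnA : G (~` A) by exact: FG.
by have [w []] := filter_ex (filterI GA GnA).
Qed.

(** The finite subcover property, for neighborhoods of the points instead of open
    sets. *)
Lemma compact_finite_selection (X : topologicalType) (I : eqType) (K : set X)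
    (D : set I) (U : I -> set X) : compact K ->
  (forall x, K x -> exists2 i, D i & nbhs x (U i)) ->
  exists s : seq I, (forall i, i \in s -> D i) /\
    (forall x, K x -> exists2 i, i \in s & U i x).
Proof.
move=> /compact_near_coveringP Kcov loc.
(* sequences of indices, filtered by inclusion *)
pose G := filter_from [set: seq I] (fun s => [set s' : seq I | {subset s <= s'}]).
have FG : Filter G.
  apply: filter_from_filter; first by exists [::].
  move=> s s' _ _; exists (s ++ s') => // s'' ss''; split => i si.
    by apply: ss''; rewrite mem_cat si.
  by apply: ss''; rewrite mem_cat si orbT.
have [|s _ sP] := Kcov (seq I) G
    (fun s x => exists2 i, i \in s & D i /\ U i x) FG.
  move=> x /loc[i Di Ui]; exists (U i, [set s : seq I | i \in s]) => /=.
    split => //; exists [:: i] => // s; apply.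
    by rewrite mem_head.
  by move=> [y s] /= [Uy si]; exists i.
exists [seq i <- s | `[< D i >]]; split => [i|x Kx].
  by rewrite mem_filter => /andP[/asboolP].
have [i si [Di Ui]] := sP s (fun _ => id) x Kx.
by exists i => //; rewrite mem_filter si andbT; apply/asboolP.
Qed.

Section penalty_levels.
Context d (T : measurableType d) (R : realType) (P : probability T R).
Context (gamma : acprob P -> \bar R) (pgamma : penalty gamma).
Implicit Types (Q : acprob P).

(** The excess Q' - (1 - t) Q1 is a nonnegative charge of total mass t, and Q is
    this charge divided by t. *)
Lemma mixture_cancel Q' Q1 (t : R) : (0 < t <= 1)%R ->
  (forall A, measurable A -> (1 - t)%:E * Q1 A <= Q' A) ->
  exists Q, forall A, measurable A -> Q' A = t%:E * Q A + (1 - t)%:E * Q1 A.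
Proof.
move=> /andP[t0 t1] dom.
pose nu : {charge set T -> \bar R} :=
  crestr0 (cscale t^-1 (cadd (charge_of_finite_measure Q')
    (cscale (- (1 - t)) (charge_of_finite_measure Q1)))) measurableT.
have nuE A : measurable A -> nu A = t^-1%:E * (Q' A - (1 - t)%:E * Q1 A).
  move=> mA; rewrite /nu/= /crestr0/= mem_set// /crestr setIT.
  by rewrite /cscale/= /cadd/= /cscale/= EFinN mulNe.
have nu0 A : 0 <= nu A.
  have [mA|mA] := pselect (measurable A); last first.
    by rewrite /nu/= /crestr0/= memNset.
  rewrite nuE// mule_ge0// ?lee_fin ?invr_ge0 ?(ltW t0)//.
  by rewrite leeBrDr ?add0e ?dom// fin_numM// fin_num_measure.
have [||Q QE] := @acprob_of_measure _ _ _ P (measure_of_charge nu nu0).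
- rewrite /= /measure_of_charge nuE// !probability_setT mule1 -EFinB -EFinM.
  by rewrite subKr mulVf// gt_eqF.
- move=> A mA PA; rewrite /= /measure_of_charge nuE//.
  by rewrite !acprob_null// mule0 sube0 mule0.
exists Q => A mA; rewrite QE/= /measure_of_charge nuE// muleA -EFinM.
by rewrite divff ?gt_eqF// mul1e subeK// fin_numM// fin_num_measure.
Qed.

(** Mixing with a fixed Q1 of penalty below 1/2, with a small weight t on Q, maps
    the level c into the compact level 1. A limit of such mixtures along an
    ultrafilter still dominates (1 - t) Q1, so it is again a mixture of Q1 with
    some Q, and Q is a limit of the original points. *)
Lemma level_compact (c : R) : compact [set Q | gamma Q <= c%:E].
Proof.
have [Q1 g1] : exists Q1, gamma Q1 < 2^-1%:E.
  have := penalty_inf0 pgamma => g0.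
  have : ereal_inf (range gamma) < 2^-1%:E by rewrite g0 lte_fin invr_gt0.
  by move=> /ereal_inf_lt[_ [Q1 _ <-] ?]; exists Q1.
pose c' := Num.max c 0%R.
have c'0 : (0 <= c')%R by rewrite le_max lexx orbT.
pose t := (2 * c' + 2)^-1%R.
have t01 : (0 < t <= 1)%R.
  by rewrite /t invr_gt0 invf_le1; first (apply/andP; split); lra.
have tc : (t * c' + (1 - t) * 2^-1 <= 1)%R.
  have : (t * (2 * c' + 2) = 1)%R by rewrite /t mulVf// gt_eqF//; lra.
  by move: t01 => /andP[]; lra.
have {}t01' : (0 <= t <= 1)%R by case/andP: t01 => /ltW -> ->.
have [mix mixE] : exists mix : acprob P -> acprob P, forall Q A, measurable A ->
    mix Q A = t%:E * Q A + (1 - t)%:E * Q1 A.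
  exists (fun Q => sval (cid (acprob_mixture Q Q1 t01'))) => Q A mA.
  by case: cid => /= Q' ->.
have mixint Q (xi : Loo P) : (\int[mix Q]_w xi w =
    t * \int[Q]_w xi w + (1 - t) * \int[Q1]_w xi w)%R.
  by have [] := mixture_integral t01' (mixE Q)
    (Loo_integrable Q xi) (Loo_integrable Q1 xi).
have mixlevel Q : gamma Q <= c%:E -> gamma (mix Q) <= 1.
  move=> gQ; apply: le_trans (penalty_convex pgamma t01' (mixE Q)) _.
  apply: (@le_trans _ _ ((t * c' + (1 - t) * 2^-1)%:E)); last by rewrite lee_fin.
  rewrite [leRHS]EFinD !EFinM leeD// lee_wpmul2l// ?lee_fin ?(ltW g1)//.
  - by case/andP: t01'.
  - by rewrite (le_trans gQ)// lee_fin le_max lexx.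
  - by case/andP: t01'; lra.
rewrite compact_ultra => F FU FK.
have := penalty_compact pgamma; rewrite compact_ultra.
move=> /(_ (mix @ F)); case.
- exact: fmap_ultra.
- have : F (mix @^-1` [set Q | gamma Q <= 1]) by apply: filterS FK => Q /mixlevel.
  by [].
move=> Q' [_ FQ'].
have tn0 : t != 0%R by case/andP: t01 => /gt_eqF ->.
have lim (xi : Loo P) : (fun Q : acprob P => \int[Q]_w xi w)%R @ F -->
    (t^-1 * (\int[Q']_w xi w - (1 - t) * \int[Q1]_w xi w))%R.
  have -> : (fun Q : acprob P => \int[Q]_w xi w)%R = (fun Q : acprob P =>
      t^-1 * (\int[mix Q]_w xi w - (1 - t) * \int[Q1]_w xi w))%R.
    by apply/funext => Q; rewrite mixint addrK mulKf//.
  apply: cvgMl_tmp; apply: cvgB; last exact: cvg_cst.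
  apply: (@cvg_comp _ _ _ mix (fun Q : acprob P => (\int[Q]_w xi w)%R) _ _ _ FQ').
  exact: Loo_integral_continuous.
have [|Q QE] := @mixture_cancel Q' Q1 t t01.
- move=> A mA.
  have [xi xiE] : exists xi : Loo P, xi = \1_A :> (T -> R).
    apply: (@Loo_of _ _ _ _ _ 1%R) => //.
    by apply: aeW => w; rewrite ger0_norm// indicE; case: (_ \in _).
  have intA Q : (\int[Q]_w xi w)%R = fine (Q A).
    by rewrite /Rintegral xiE integral_indic// setIT.
  have := lim xi; rewrite !intA => limA.
  have : (0 <= t^-1 * (fine (Q' A) - (1 - t) * fine (Q1 A)))%R.
    rewrite -(cvg_lim _ limA)//; apply: limr_ge; first by apply: cvgP limA.
    by apply: nearW => Q; rewrite intA fine_ge0.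
  have tV0 : (0 < t^-1)%R by rewrite (invr_gt0 t); case/andP: t01.
  rewrite pmulr_rge0//.
  rewrite subr_ge0 -lee_fin EFinM !fineK//; exact: fin_num_measure.
exists Q.
have FQ : F --> Q.
  apply: acprob_cvgP => xi; rewrite [X in _ --> X](_ : _ =
    t^-1 * (\int[Q']_w xi w - (1 - t) * \int[Q1]_w xi w))%R//.
  have [_ ->] := mixture_integral t01' QE
    (Loo_integrable Q xi) (Loo_integrable Q1 xi).
  by rewrite addrK mulKf.
split => //=; rewrite leNgt; apply/negP => cQ.
have [V QV Vc] := penalty_lsc pgamma cQ.
have [Q2 [/Vc + KQ2]] := filter_ex (filterI (FQ _ QV) FK).
by rewrite ltNge KQ2.
Qed.

End penalty_levels.

(** * Integrability from the spaces of the risk measure *)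

Section orlicz_type_spaces.
Context d (T : measurableType d) (R : realType) (P : probability T R).
Context (gamma : acprob P -> \bar R) (pgamma : penalty gamma).
Implicit Types (Q : acprob P) (g : T -> \bar R).

Lemma penalty_fineK Q : fin_penalty gamma Q -> (fine (gamma Q))%:E = gamma Q.
Proof. by move=> Qfin; rewrite fineK// ge0_fin_numE// (penalty_ge0 pgamma). Qed.

Lemma rho_ge Q g : fin_penalty gamma Q ->
  \int[Q]_w g w <= rho gamma g + gamma Q.
Proof.
move=> Qfin; rewrite -leeBlDr; last first.
  by rewrite ge0_fin_numE// (penalty_ge0 pgamma).
by apply: ereal_sup_ubound; exists Q.
Qed.

Lemma Lrho_integrable Q g : Lrho gamma g -> fin_penalty gamma Q ->
  Q.-integrable setT g.
Proof.
move=> [[mg _] [a a0 rg]] Qfin; apply/integrableP; split => //.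
have := rho_ge (fun w => a%:E * `|g w|) Qfin.
rewrite ge0_integralZl//; first last.
- by rewrite lee_fin ltW.
- exact: measurableT_comp.
move=> le_rho; rewrite ltNge leye_eq; apply/negP => /eqP goo.
move: le_rho; rewrite goo gt0_muley ?lte_fin// leye_eq => /eqP.
by apply/eqP; rewrite lt_eqF// lte_add_pinfty.
Qed.

(** Uniform integrability, relative to the weights 1 + gamma Q: once rho of the
    tail of g / e is below 1, the Q-mean of that tail is at most
    1 + gamma Q. *)
Lemma Mrhou_uniform_integrability g (e : R) : Mrhou gamma g -> (0 < e)%R ->
  exists2 M : R, (0 <= M)%R & forall Q, fin_penalty gamma Q ->
    let h := (fun w => Num.max (fine (g w) - M) 0)%R in
    Q.-integrable setT (EFin \o h) /\
    (\int[Q]_w h w <= e * (1 + fine (gamma Q)))%R.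
Proof.
move=> [[mg _] gM] e0.
have ei0 : (0 < e^-1)%R by rewrite invr_gt0.
have [N rN] : exists N : nat, rho gamma (fun w => e^-1%:E * `|g w| *
    (\1_[set v : T | ((N%:R)%:E < `|g v|)%E] w)%:E) < 1.
  have : nbhs (0 : \bar R) [set x | x < 1].
    by apply: open_nbhs_nbhs; split; [exact: open_ereal_lt_ereal|exact: lte01].
  by move=> /(gM _ ei0)[N _ /(_ N)/(_ (leqnn N))] ?; exists N.
exists N%:R => // Q Qfin h.
have mh : measurable_fun setT h.
  apply: measurable_maxr => //; apply: measurable_funB => //.
  exact: measurableT_comp.
have h0 w : (0 <= h w)%R by rewrite le_max lexx orbT.
have hg w : (e^-1 * h w)%:E <= e^-1%:E * `|g w| *
    (\1_[set v : T | ((N%:R)%:E < `|g v|)%E] w)%:E.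
  rewrite indicE; have [|] := boolP (w \in _); rewrite ?inE ?notin_setE/= => Ng.
    rewrite mule1 EFinM lee_wpmul2l ?lee_fin ?(ltW ei0)// /h.
    case: (g w) Ng => [r||]/= Ng.
    - by rewrite lee_fin ge_max normr_ge0 andbT; have := ler_norm r; have := ler0n R N; lra.
    - by rewrite leey.
    - by rewrite leey.
  rewrite mule0 lee_fin pmulr_rle0// ge_max lexx andbT.
  move: Ng; case: (g w) => [r||]/= /negP; rewrite -leNgt ?leye_eq// lee_fin.
  by have := ler_norm r; lra.
have int_le : e^-1%:E * \int[Q]_w (h w)%:E <= 1 + gamma Q.
  apply: (@le_trans _ _ (rho gamma (fun w => e^-1%:E * `|g w| *
    (\1_[set v : T | ((N%:R)%:E < `|g v|)%E] w)%:E) + gamma Q)); last first.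
    by rewrite leeD2r// ltW.
  apply: le_trans (rho_ge _ Qfin).
  rewrite -ge0_integralZl//; first last.
  - by rewrite lee_fin ltW.
  - by move=> w _; rewrite lee_fin.
  - exact/measurable_EFinP.
  apply: ge0_le_integral => //.
    - by move=> w _; rewrite -EFinM lee_fin mulr_ge0// ltW.
    - by apply: measurable_funeM; exact/measurable_EFinP.
    - apply: emeasurable_funM.
        by apply: measurable_funeM; exact: measurableT_comp.
      apply/measurable_EFinP/measurable_indic.
      rewrite -[X in measurable X]setTI; apply: emeasurable_fun_o_infty => //.
      exact: measurableT_comp.
    - by move=> w _; rewrite -EFinM.
have hfin : \int[Q]_w (h w)%:E \is a fin_num.
  rewrite ge0_fin_numE; last by apply: integral_ge0 => w _; rewrite lee_fin.
  rewrite ltNge leye_eq; apply/negP => /eqP hoo.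
  have := int_le; rewrite hoo gt0_muley ?lte_fin// leye_eq => /eqP.
  by apply/eqP; rewrite lt_eqF// lte_add_pinfty// ltry.
split.
  apply/integrableP; split; first exact/measurable_EFinP.
  under eq_integral do rewrite /= ger0_norm//.
  by rewrite ltey_eq hfin.
have := int_le; rewrite -(fineK hfin) -(penalty_fineK Qfin) -EFinM -EFinD lee_fin.
by rewrite ler_pdivrMl.
Qed.

End orlicz_type_spaces.

(** * Conjugates of integrands and countable families of candidates *)

Section integrand_conjugates.
Context d (T : measurableType d) (R : realType).
Implicit Types (h : T -> R -> \bar R).

Lemma conjugate_persp h w y : conjugate h w y = persp_conjugate h w y 1.
Proof.
rewrite /conjugate /persp_conjugate; apply/eqP; rewrite eq_le; apply/andP; split.
  apply: ge_ereal_sup => _ [x _ <-]; have [hx|] := ltP (h w x) +oo.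
    by apply: ereal_sup_ubound; exists x; rewrite ?mul1e.
  by rewrite leye_eq => /eqP ->; rewrite addeNy leNye.
apply: ge_ereal_sup => _ [x _ <-]; rewrite mul1e.
by apply: ereal_sup_ubound; exists x.
Qed.

Lemma conjugate_ge h w x y : (x * y)%:E - h w x <= conjugate h w y.
Proof. by apply: ereal_sup_ubound; exists x. Qed.

Lemma conjugate_minorant h w y (b : R) : conjugate h w y <= b%:E ->
  forall x, (y * x - b)%:E <= h w x.
Proof.
move=> yb x; have := le_trans (conjugate_ge h w x y) yb.
case: (h w x) => [r||]; rewrite ?leey//.
by rewrite -EFinB !lee_fin; lra.
Qed.

Lemma conjugate_econvex h w : econvex (conjugate h w).
Proof.
move=> y1 y2 t /andP[t0 t1]; apply: ge_ereal_sup => _ [x _ <-].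
have := conjugate_ge h w x y1; have := conjugate_ge h w x y2.
have t1' : (0 <= 1 - t)%R by lra.
case: (h w x) => [r| |]; rewrite ?addeNy ?leNye// => h2 h1.
  have -> : (x * (t * y1 + (1 - t) * y2))%:E - r%:E =
      t%:E * ((x * y1)%:E - r%:E) + (1 - t)%:E * ((x * y2)%:E - r%:E).
    by rewrite -!EFinB -!EFinM -EFinD; congr (_%:E); ring.
  by rewrite leeD// lee_wpmul2l// lee_fin.
move: h1 h2; rewrite /= !leye_eq => /eqP -> /eqP ->.
have [->|tn0] := eqVneq t 0%R.
  by rewrite mul0e add0e subr0 mul1e.
rewrite gt0_muley ?lte_fin ?lt_neqAle 1?eq_sym ?tn0// addye ?leey//.
by case: ltgtP t1' => // [t2 _|<- _]; rewrite ?mul0e ?gt0_muley.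
Qed.

(** Fenchel-Moreau in one variable: any value a below h at x is the height at x
    of an affine minorant of h, by [econvex_minorant]. *)
Lemma biconjugate h w c b x : econvex (h w) -> (forall u, -oo < h w u) ->
  lower_semicontinuous (h w) -> conjugate h w c <= b%:E ->
  persp_conjugate (conjugate h) w x 1 = h w x.
Proof.
move=> cvxh hNy lsch cb; apply/eqP; rewrite eq_le; apply/andP; split.
  apply: ge_ereal_sup => _ [y hy <-]; rewrite mul1e.
  have := conjugate_ge h w x y; move: hy => /=.
  case: (h w x) (hNy x) => [r||]// _; rewrite ?leey//.
  by case: (conjugate h w y) => [s||]//= _; rewrite ?lee_fin; lra.
rewrite leNgt; apply/negP; set s := persp_conjugate _ _ _ _ => sx.
have sge y : conjugate h w y < +oo -> (y * x)%:E - conjugate h w y <= s.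
  by move=> hy; apply: ereal_sup_ubound; exists y; rewrite ?mul1e.
have [a sa ax] := ereal_between sx.
have [y yP] := econvex_minorant cvxh hNy lsch (conjugate_minorant cb) ax.
have yb : conjugate h w y <= (y * x - a)%:E.
  apply: ge_ereal_sup => _ [u _ <-]; have := yP u.
  case: (h w u) => [r||]//=; rewrite ?addeNy ?leNye//.
  by rewrite -EFinB !lee_fin; lra.
have := sge y (le_lt_trans yb (ltry _)); rewrite leNgt => /negP; apply.
apply: (lt_le_trans sa).
move: yb; case: (conjugate h w y) => [r||]//=; rewrite ?leey//.
by rewrite -EFinB !lee_fin; lra.
Qed.

(** The bound k keeps h along each candidate below k or below h along x0, which
    makes candidates admissible competitors. The outer option type reserves an
    index for x0 itself. *)
Definition candidate h (x0 : T -> R) (n : nat) (w : T) : R :=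
  if @unpickle (option (rat * nat)) n is Some (Some (q, k)) then
    if h w (ratr q) <= k%:R%:E then ratr q else x0 w
  else x0 w.

Lemma candidateP h x0 n : exists (q : R) (k : nat), forall w,
  candidate h x0 n w = x0 w \/
  candidate h x0 n w = q /\ h w q <= k%:R%:E.
Proof.
rewrite /candidate; case: unpickle => [[[q k]|]|].
- by exists (ratr q), k => w; case: ifP; [right|left].
- by exists 0%R, 0%N => w; left.
- by exists 0%R, 0%N => w; left.
Qed.

Lemma candidate_measurable h x0 n : measurable_fun setT x0 ->
  (forall q : rat, measurable_fun setT (fun w => h w (ratr q))) ->
  measurable_fun setT (candidate h x0 n).
Proof.
move=> mx0 mh; rewrite /candidate; case: unpickle => [[[q k]|]|]//.
by apply: measurable_fun_ifT => //; exact: measurable_fun_lee.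
Qed.

(** Convexity along the segment from x0 w makes rational points suffice: when
    the domain of h w is not the singleton of x0 w, it has an interior, which
    is dense in it. *)
Lemma candidate_sup h x0 w y z : econvex (h w) -> (forall u, -oo < h w u) ->
  h w (x0 w) < +oo -> (0 <= z)%R ->
  persp_conjugate h w y z = ereal_sup (range (fun n =>
    (candidate h x0 n w * y - z * fine (h w (candidate h x0 n w)))%:E)).
Proof.
move=> cvxh hNy hx0 z0; set s := ereal_sup _.
have sge n : (candidate h x0 n w * y -
    z * fine (h w (candidate h x0 n w)))%:E <= s.
  by apply: ereal_sup_ubound; exists n.
have candoo n : h w (candidate h x0 n w) < +oo.
  have [q [k /(_ w)[->//|[-> hq]]]] := candidateP h x0 n.
  by rewrite (le_lt_trans hq)// ltry.
apply/eqP; rewrite eq_le; apply/andP; split; last first.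
  apply: ge_ereal_sup => _ [n _ <-]; apply: ereal_sup_ubound.
  exists (candidate h x0 n w); first exact: candoo.
  have [r ->] := fin_of_lty hNy (candoo n).
  by rewrite -EFinM -EFinB.
apply: ge_ereal_sup => _ [x hx <-]; rewrite leNgt; apply/negP => sx.
have sNy : -oo < s by apply: lt_le_trans (sge 0%N); rewrite ltNyr.
have [r hr] := fin_of_lty hNy hx.
have [a sE] : exists a, s = a%:E.
  by move: sx sNy; rewrite hr; case: (s) => // a; exists a.
have [xE|xx0] := eqVneq x (x0 w).
  have := sge (pickle (None : option (rat * nat))).
  rewrite /candidate pickleK leNgt => /negP; apply.
  rewrite (lt_le_trans sx)//. by rewrite -xE hr -EFinM -EFinB.
rewrite sE in sx.
have [q [hq aq]] := econvex_rat_approx cvxh hNy hx0 hx z0 xx0 sx.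
have [b hb] := fin_of_lty hNy hq.
have := sge (pickle (Some (q, (Num.truncn b).+1))).
rewrite /candidate pickleK hb lee_fin (ltW (truncnS_gt b))/= hb/= sE leNgt.
by move=> /negP; apply; rewrite (lt_le_trans aq)// hb -EFinM -EFinB.
Qed.

End integrand_conjugates.

(** * The good functions *)

Section duality.
Context d (T : measurableType d) (R : realType) (P : probability T R).
Context (completeP : measure_is_complete P).
Context (gamma : acprob P -> \bar R) (pgamma : penalty gamma).
Context (f : T -> R -> \bar R) (nf : normal_convex_integrand P f).
(* F and u stand for the positive parts of f(., xi0) and of f^*(., eta0); F_UI
   is what the membership of the former in M_u provides *)
Context (F u eta0 : T -> R) (xi0 : Loo P).
Implicit Types (Q : acprob P) (x y : T -> R) (xi : Loo P) (eta : L1 P).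

Definition regular w := [/\ econvex (f w), lower_semicontinuous (f w),
  f w (xi0 w) <= (F w)%:E & conjugate f w (eta0 w) <= (u w)%:E].

Context (reg : {ae P, forall w, regular w}).
Context (F_ge0 : forall w, (0 <= F w)%R).
Context (measurable_eta0 : measurable_fun setT eta0).
Context (eta0_int : forall Q, fin_penalty gamma Q ->
  Q.-integrable setT (EFin \o eta0)).
Context (u_int : forall Q, fin_penalty gamma Q -> Q.-integrable setT (EFin \o u)).
Context (F_UI : forall e : R, (0 < e)%R ->
  exists2 M : R, (0 <= M)%R & forall Q, fin_penalty gamma Q ->
    let h := (fun w => Num.max (F w - M) 0)%R in
    Q.-integrable setT (EFin \o h) /\
    (\int[Q]_w h w <= e * (1 + fine (gamma Q)))%R).
Context (mF : measurable_fun setT F).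

Let fNy w v : -oo < f w v. Proof. exact: integrand_gtNy nf w v. Qed.

Definition fval x w : R := fine (f w (x w)).

Lemma integrand_measurableT x : measurable_fun setT x ->
  measurable_fun setT (fun w => f w (x w)).
Proof.
move=> mx.
exact: (measurableT_comp (integrand_measurable nf)
  (measurable_fun_pair (@measurable_id _ T setT) mx)).
Qed.

Lemma fval_measurable x : measurable_fun setT x -> measurable_fun setT (fval x).
Proof. by move=> /integrand_measurableT; apply: measurableT_comp. Qed.

(** From below, f(x) is controlled by the affine minorant of slope eta0. *)
Lemma fval_integrable x (h : T -> R) (k : R) Q : measurable_fun setT x ->
  {ae P, forall w, (`|x w| <= k)%R} -> {ae P, forall w, f w (x w) <= (h w)%:E} ->
  fin_penalty gamma Q -> Q.-integrable setT (EFin \o h) ->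
  Q.-integrable setT (EFin \o fval x).
Proof.
move=> mx xk fh Qfin ih.
have ib : Q.-integrable setT (EFin \o (fun w => `|h w| + (k * `|eta0 w| + `|u w|))%R).
  have -> : EFin \o (fun w => `|h w| + (k * `|eta0 w| + `|u w|))%R =
    (EFin \o (fun w => `|h w|%R)) \+ ((fun w => k%:E * (EFin \o (fun w => `|eta0 w|%R)) w) \+
      (EFin \o (fun w => `|u w|%R))) by [].
  apply: integrableD => //; first exact: integrable_norm.
  apply: integrableD => //; last by apply: integrable_norm => //; exact: u_int.
  by apply: integrableZl => //; apply: integrable_norm => //; exact: eta0_int.
apply: ae_integrableP ib; first exact: fval_measurable.
apply: acprob_ae; apply: filterS3 reg xk fh => w [_ _ _ cu] xk fh.
have := conjugate_minorant cu (x w); rewrite /fval.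
have [r fr] := fin_of_lty (fNy w) (le_lt_trans fh (ltry _)).
move: fh; rewrite fr !lee_fin /= => rh ur.
have : (`|eta0 w * x w| <= k * `|eta0 w|)%R by rewrite normrM mulrC ler_wpM2r.
have := ler_norm (h w); have := ler_norm (u w).
have := normr_ge0 (h w); have := normr_ge0 (u w).
move=> u0 h0 un hn ex; rewrite ler_norml.
have := ler_norm (- (eta0 w * x w))%R; rewrite normrN => en.
by apply/andP; split; have := normr_ge0 (eta0 w * x w)%R; lra.
Qed.

(** This set is stable under pasting and convex combination, and the uniform
    integrability of F passes to the positive part of f along it. *)
Definition good x := measurable_fun setT x /\ exists k : R,
  {ae P, forall w, (`|x w| <= k)%R /\ f w (x w) <= (F w + k)%:E}.

Lemma good_xi0 : good xi0.
Proof.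
split; first exact: measurable_funPT.
have [k k0 xk] := Loo_ae_bounded xi0; exists k.
apply: filterS2 reg xk => w [_ _ fF _] xk; split => //.
by rewrite (le_trans fF)// lee_fin lerDl.
Qed.

Lemma good_mono x (k k' : R) w : (k <= k')%R ->
  (`|x w| <= k)%R /\ f w (x w) <= (F w + k)%:E ->
  (`|x w| <= k')%R /\ f w (x w) <= (F w + k')%:E.
Proof.
move=> kk [xk fk]; split; first exact: le_trans kk.
by rewrite (le_trans fk)// lee_fin lerD2l.
Qed.

Lemma good_paste x y (b : T -> bool) : measurable_fun setT b ->
  good x -> good y -> good (fun w => if b w then x w else y w).
Proof.
move=> mb [mx [k kP]] [my [l lP]]; split; first exact: measurable_fun_ifT.
exists (Num.max k l); apply: filterS2 kP lP => w kP lP; case: (b w).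
  by apply: good_mono kP; rewrite le_max lexx.
by apply: good_mono lP; rewrite le_max lexx orbT.
Qed.

Lemma good_candidate n : good (candidate f xi0 n).
Proof.
have [mxi0 [k kP]] := good_xi0; split.
  by apply: candidate_measurable => // q; exact: integrand_measurableT.
have [q [l candE]] := candidateP f xi0 n.
exists (Num.max k (`|q| + l%:R))%R; apply: filterS kP => w kP.
have [->|[-> fq]] := candE w.
  by apply: good_mono kP; rewrite le_max lexx.
split; first by rewrite le_max lerDl ler0n orbT.
rewrite (le_trans fq)// lee_fin.
have : (`|q| + l%:R <= Num.max k (`|q| + l%:R))%R by rewrite le_max lexx orbT.
by have := F_ge0 w; have := normr_ge0 q; lra.
Qed.

Lemma good_convex x y (t : R) : (0 <= t <= 1)%R -> good x -> good y ->
  good (fun w => t * x w + (1 - t) * y w)%R.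
Proof.
move=> /andP[t0 t1] [mx [k kP]] [my [l lP]].
have t1' : (0 <= 1 - t)%R by lra.
split; first by apply: measurable_funD; exact: measurable_funM.
exists (Num.max k l); apply: filterS3 reg kP lP => w [cvx _ _ _] kP lP.
have /good_mono/(_ kP)[xm fxm] : (k <= Num.max k l)%R by rewrite le_max lexx.
have /good_mono/(_ lP)[ym fym] : (l <= Num.max k l)%R.
  by rewrite le_max lexx orbT.
split.
  rewrite (le_trans (ler_normD _ _))// !normrM (ger0_norm t0) (ger0_norm t1').
  by nra.
apply: le_trans (cvx _ _ _ _) _; first by rewrite t0.
apply: (@le_trans _ _ (t%:E * (F w + Num.max k l)%:E +
  (1 - t)%:E * (F w + Num.max k l)%:E)).
  by rewrite leeD// lee_wpmul2l// lee_fin.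
by rewrite -!EFinM -EFinD lee_fin; lra.
Qed.

Lemma F_int Q : fin_penalty gamma Q -> Q.-integrable setT (EFin \o F).
Proof.
move=> Qfin; have [M M0 /(_ _ Qfin)[/= ih _]] := F_UI ltr01.
apply: (@ae_integrableP _ _ _ _ _ (fun w => Num.max (F w - M) 0 + M)%R) => //.
  apply: aeW => w; rewrite ger0_norm//.
  have : (F w - M <= Num.max (F w - M) 0)%R by rewrite le_max lexx.
  by lra.
have -> : EFin \o (fun w => Num.max (F w - M) 0 + M)%R =
  (EFin \o (fun w => Num.max (F w - M) 0)%R) \+ (EFin \o cst M) by [].
by apply: integrableD => //; exact: finite_measure_integrable_cst.
Qed.

Lemma good_integrable x Q : good x -> fin_penalty gamma Q ->
  Q.-integrable setT (EFin \o fval x).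
Proof.
move=> [mx [k kP]] Qfin.
apply: (@fval_integrable _ (fun w => F w + k)%R k) => //.
- by apply: filterS kP => w [].
- by apply: filterS kP => w [].
have -> : EFin \o (fun w => F w + k)%R = (EFin \o F) \+ (EFin \o cst k) by [].
apply: integrableD => //; first exact: F_int.
exact: finite_measure_integrable_cst.
Qed.

Lemma good_fval x : good x -> {ae P, forall w, f w (x w) = (fval x w)%:E}.
Proof.
move=> [_ [k kP]]; apply: filterS kP => w [_ fk].
by rewrite /fval; have [r ->] := fin_of_lty (fNy w) (le_lt_trans fk (ltry _)).
Qed.

Lemma good_Loo x : good x -> exists xi, xi = x :> (T -> R).
Proof.
move=> [mx [k kP]]; apply: (@Loo_of _ _ _ _ _ k) => //.
by apply: filterS kP => w [].
Qed.

(** Almost surely a supremum over the countable family of candidates; the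
    exceptional null set is harmless by completeness. *)
Lemma persp_measurable y (z : T -> R) : measurable_fun setT y -> measurable_fun setT z ->
  {ae P, forall w, (0 <= z w)%R} ->
  measurable_fun setT (fun w => persp_conjugate f w (y w) (z w)).
Proof.
move=> my mz z0.
pose g n w := (candidate f xi0 n w * y w - z w * fval (candidate f xi0 n) w)%:E.
have mg n : measurable_fun setT (g n).
  have [mc _] := good_candidate n.
  apply/measurable_EFinP/measurable_funB; apply: measurable_funM => //.
  exact: fval_measurable.
apply: (ae_measurable_fun completeP _ (measurable_fun_esups mg 0%N)).
apply: filterS2 reg z0 => w [cvx _ fF _] z0 _.
rewrite (candidate_sup _ cvx (fNy w) (le_lt_trans fF (ltry _)) z0).
by congr ereal_sup; rewrite eqEsubset; split => r [n _ <-]; exists n.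
Qed.

(** * Interchange and weak duality *)

Lemma lagrangian_integral eta xi Q : Q.-integrable setT (EFin \o fval xi) ->
  P.-integrable setT
    (EFin \o (fun w => xi w * eta w - density Q w * fval xi w)%R) /\
  \int[P]_w (xi w * eta w - density Q w * fval xi w)%:E =
    (\int[P]_w (xi w * eta w) - \int[Q]_w fval xi w)%:E.
Proof.
move=> iQ; have [i1 _] := expectation_Loo_L1 xi eta.
have [i2 e2] := density_integrable iQ.
have dE : (fun w => fval xi w * density Q w)%R = (fun w => density Q w * fval xi w)%R.
  by apply/funext => w; rewrite mulrC.
rewrite dE in i2.
have -> : EFin \o (fun w => xi w * eta w - density Q w * fval xi w)%R =
  (EFin \o (fun w => xi w * eta w)%R) \-
    (EFin \o (fun w => density Q w * fval xi w)%R) by [].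
split; first exact: integrableB.
transitivity (\int[P]_w (((EFin \o (fun w => xi w * eta w)%R) \-
    (EFin \o (fun w => density Q w * fval xi w)%R)) w)); first by [].
rewrite integralB// EFinB /Rintegral !fineK ?integrable_fin_num//.
congr (_ - _); rewrite -e2; apply: eq_integral => w _.
by rewrite /= mulrC.
Qed.

(** The second hypothesis puts xi w in the domain of f w even where the density
    of Q vanishes: there the perspective conjugate is the support function of
    the domain. *)
Lemma Hdiv_ge eta xi Q : Q.-integrable setT (EFin \o fval xi) ->
  {ae P, forall w, f w (xi w) = (fval xi w)%:E} ->
  (\int[P]_w (xi w * eta w) - \int[Q]_w fval xi w)%:E <= Hdiv f eta Q.
Proof.
move=> iQ fE; have [iP <-] := lagrangian_integral eta iQ.
apply: ae_le_integral; first exact: measurable_int iP.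
  exact: persp_measurable (density_ge0 Q).
apply: filterS fE => w fE; apply: ereal_sup_ubound; exists (xi w).
  by rewrite /= fE ltry.
by rewrite fE -EFinM -EFinB.
Qed.

(** The candidates built from xi0 are good, and good functions can be pasted, so
    that [interchange_sup] applies. *)
Lemma Hdiv_approx eta Q (a : \bar R) : fin_penalty gamma Q ->
  a < Hdiv f eta Q -> exists2 xi : Loo P, good xi &
  a < (\int[P]_w (xi w * eta w) - \int[Q]_w fval xi w)%:E.
Proof.
move=> Qfin aH.
have lag x : good x -> exists xi, [/\ xi = x :> (T -> R), good xi &
    Q.-integrable setT (EFin \o fval xi)].
  move=> gx; have [xi xiE] := good_Loo gx; exists xi.
  by split=> //; rewrite xiE//; exact: good_integrable.
have [||||x gx ax] := @interchange_sup _ _ _ P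
  (fun w v => v * eta w - density Q w * fine (f w v))%R good
  (candidate f xi0) _ a _ good_candidate _ _ _ aH.
- by move=> x y b mb gx gy; exact: good_paste.
- by move=> x /lag[xi [<- _ /(lagrangian_integral eta)[]]].
- exact: persp_measurable (density_ge0 Q).
- apply: filterS2 reg (density_ge0 Q) => w [cvx _ fF _] d0.
  exact: candidate_sup cvx (fNy w) (le_lt_trans fF (ltry _)) d0.
have [xi [xE gxi iQ]] := lag _ gx.
exists xi => //; rewrite -(lagrangian_integral eta iQ).2.
by move: ax; rewrite -xE.
Qed.

Lemma integrand_lower xi : exists2 g : T -> R,
  (forall Q, fin_penalty gamma Q -> Q.-integrable setT (EFin \o g)) &
  {ae P, forall w, (g w)%:E <= f w (xi w)}.
Proof.
have [k k0 xk] := Loo_ae_bounded xi.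
exists (fun w => - (k * `|eta0 w|) - u w)%R => [Q Qfin|].
  have -> : EFin \o (fun w => - (k * `|eta0 w|) - u w)%R =
    (fun w => (- k)%:E * (EFin \o (fun w => `|eta0 w|%R)) w) \- (EFin \o u).
    by apply/funext => w; rewrite /= -mulNr.
  apply: integrableB => //; last exact: u_int.
  by apply: integrableZl => //; apply: integrable_norm => //; exact: eta0_int.
apply: filterS2 reg xk => w [_ _ _ cu] xk.
apply: le_trans (conjugate_minorant cu (xi w)); rewrite lee_fin lerD2r.
have : (`|eta0 w * xi w| <= k * `|eta0 w|)%R by rewrite normrM mulrC ler_wpM2r.
by have := ler_norm (- (eta0 w * xi w))%R; rewrite normrN; lra.
Qed.

(** Finiteness of the functional at xi forces xi into the domain P-almost
    surely, because some probability of finite penalty is equivalent to P. *)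
Lemma Ifun_lty_fval xi : Ifun f gamma xi < +oo ->
  {ae P, forall w, f w (xi w) = (fval xi w)%:E} /\
  forall Q, fin_penalty gamma Q -> Q.-integrable setT (EFin \o fval xi).
Proof.
move=> Ioo; have mf := integrand_measurableT (measurable_funPT xi).
have [g ig gf] := integrand_lower xi.
have fint Q : fin_penalty gamma Q ->
    Q.-integrable setT (fun w => f w (xi w)).
  move=> Qfin; apply: (integrable_of_minorant (ig _ Qfin)) => //.
    exact: acprob_ae.
  apply: (@le_lt_trans _ _ (Ifun f gamma xi + gamma Q)).
    rewrite -leeBlDr; last by rewrite -(penalty_fineK pgamma Qfin).
    by apply: ereal_sup_ubound; exists Q.
  by rewrite lte_add_pinfty.
split; last first.
  move=> Q Qfin; apply: le_integrable (fint _ Qfin) => //.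
    by apply/measurable_EFinP/fval_measurable.
  by move=> w _; rewrite /= /fval; case: (f w (xi w)) => [r||]//=; rewrite leey.
have [Q0 [PQ0 Q0fin]] := penalty_equiv pgamma.
have [N [mN N0 fN]] := integrable_ae measurableT (fint _ Q0fin).
exists N; split => //.
  apply: (PQ0 N) => // A mA AN.
  exact: (subset_measure0 _ _ AN).
move=> w /= fw; apply: fN => /=; apply: contra_not fw => /(_ I) /fineK.
by rewrite /fval => ->.
Qed.

Lemma integral_fval xi Q : {ae P, forall w, f w (xi w) = (fval xi w)%:E} ->
  Q.-integrable setT (EFin \o fval xi) ->
  \int[Q]_w f w (xi w) = (\int[Q]_w fval xi w)%:E.
Proof.
move=> fE iQ; rewrite /Rintegral fineK ?integrable_fin_num//.
apply: ae_eq_integral => //.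
- exact: integrand_measurableT.
- exact: measurable_int iQ.
- by have := acprob_ae Q fE; apply: filterS => w fw _.
Qed.

Lemma Iconj_le_Hpen eta : Iconj f gamma eta <= Hpen f gamma eta.
Proof.
apply: ge_ereal_sup => _ [xi _ <-].
have [_ ->] := expectation_Loo_L1 xi eta.
have [Ioo|] := ltP (Ifun f gamma xi) +oo; last first.
  by rewrite leye_eq => /eqP ->; rewrite addeNy leNye.
have [fE fint] := Ifun_lty_fval Ioo.
apply: le_ereal_inf_tmp => _ [Q Qfin <-].
have gE := penalty_fineK pgamma Qfin.
have le1I : (\int[Q]_w fval xi w)%:E - gamma Q <= Ifun f gamma xi.
  rewrite -(integral_fval fE (fint _ Qfin)).
  by apply: ereal_sup_ubound; exists Q.
apply: le_trans (leeD2r _ (Hdiv_ge eta (fint _ Qfin) fE)).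
rewrite -gE in le1I *; move: le1I Ioo; rewrite -EFinB.
case: (Ifun f gamma xi) => [r||]//= + _.
by rewrite -EFinB -EFinD !lee_fin; lra.
Qed.

(** * Minimax *)

Lemma truncation_mean (Q : acprob P) (g : T -> R) (e : R) : (0 < e)%R ->
  Q.-integrable setT (EFin \o g) ->
  exists N : nat, Q.-integrable setT (EFin \o (fun w => Num.max (g w) (- N%:R))%R) /\
    (\int[Q]_w Num.max (g w) (- N%:R) <= \int[Q]_w g w + e)%R.
Proof.
move=> e0 ig; have mg : measurable_fun setT g.
  by apply/measurable_EFinP; exact: measurable_int ig.
pose G (n : nat) w := (Num.max (g w) (- n%:R))%:E.
have mG n : measurable_fun setT (G n).
  by apply/measurable_EFinP/measurable_maxr.
have dom n w : `|G n w| <= `|g w|%:E.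
  rewrite lee_fin /G maxEle; case: ifP => // gn; rewrite normrN ger0_norm//.
  have := ler_norm (- g w)%R; rewrite normrN.
  by have := ler0n R n; lra.
have iabs := integrable_norm ig.
have [] := @dominated_convergence _ _ _ Q setT measurableT G (EFin \o g)
  (EFin \o (fun w => `|g w|)%R) mG (measurable_int _ ig).
- apply: aeW => w _; apply: cvg_near_cst.
  exists (Num.truncn `|g w|).+1 => // n /= nw.
  rewrite /G max_l//.
  have := truncnS_gt `|g w|%R; have : ((Num.truncn `|g w|).+1%:R <= n%:R :> R)%R.
    by rewrite ler_nat.
  by have := ler_norm (- g w)%R; rewrite normrN; lra.
- exact: iabs.
- by apply: aeW => w n _; exact: dom.
move=> _ _ cvgI.
have iG n : Q.-integrable setT (G n).
  by apply: le_integrable iabs => // w _; rewrite /= normr_id; exact: dom.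
have fing := integrable_fin_num measurableT ig.
have : nbhs (\int[Q]_w (EFin \o g) w) [set y | y < \int[Q]_w (EFin \o g) w + e%:E].
  apply: open_nbhs_nbhs; split; first exact: open_ereal_lt_ereal.
  by rewrite /= lteDl// lte_fin.
move=> /cvgI[N _ /(_ N (leqnn N))] /= GN.
exists N; split; first exact: iG.
rewrite -lee_fin EFinD /Rintegral !fineK ?ltW//.
exact: (integrable_fin_num measurableT (iG N)).
Qed.

(** For good xi, the infimum over Q is E[xi eta] - I(xi), and the supremum over
    good xi is H(eta|Q) + gamma(Q). *)
Definition lagrangian eta xi Q : R :=
  (\int[P]_w (xi w * eta w) - \int[Q]_w fval xi w + fine (gamma Q))%R.

(** Up to a small error, f(xi) can be replaced by a bounded function, whose mean
    depends continuously on Q. The error of truncating from above is uniform on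
    the level set, by uniform integrability; the truncation from below only
    increases f(xi), so that its error matters at Q only. *)
Lemma lagrangian_lsc eta xi Q (c a : R) : good xi -> gamma Q <= c%:E ->
  (a < lagrangian eta xi Q)%R ->
  nbhs Q [set Q' | gamma Q' <= c%:E -> (a < lagrangian eta xi Q')%R].
Proof.
move=> gxi Qc aQ; have Qfin : fin_penalty gamma Q by apply: le_lt_trans Qc (ltry _).
have iQ := good_integrable gxi Qfin.
(* e is spent on each of: both truncations, the mean of the bounded function,
   and the penalty *)
pose e := ((lagrangian eta xi Q - a) / 4)%R.
have e0 : (0 < e)%R by rewrite /e; lra.
have c0 : (0 <= c)%R by rewrite -lee_fin (le_trans (penalty_ge0 pgamma Q)).
have e'0 : (0 < e / (1 + c))%R by rewrite divr_gt0//; lra.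
have [M M0 MP] := F_UI e'0.
have [N [iN NP]] := truncation_mean e0 iQ.
have [mxi [k kP]] := gxi.
pose B := (M + `|k|)%R.
have B0 : (0 <= B)%R by rewrite addr_ge0.
pose h w := (Num.min (Num.max (fval xi w) (- N%:R)) B)%R.
have mh : measurable_fun setT h.
  apply: measurable_minr => //; apply: measurable_maxr => //.
  exact: fval_measurable.
have [zeta zetaE] : exists zeta : Loo P, zeta = h :> (T -> R).
  apply: (@Loo_of _ _ _ _ _ (N%:R + B)%R) => //.
  apply: aeW => w; rewrite ler_norml /h le_min ge_min le_max.
  have := ler0n R N => N0; apply/andP; split; [apply/andP; split|apply/orP; right].
  - by apply/orP; right; lra.
  - by lra.
  - by lra.
have ih Q' : Q'.-integrable setT (EFin \o h).
  by rewrite -zetaE; exact: Loo_integrable.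
have upper Q' : gamma Q' <= c%:E ->
    (\int[Q']_w fval xi w <= \int[Q']_w h w + e)%R.
  move=> Q'c; have Q'fin : fin_penalty gamma Q' by apply: le_lt_trans Q'c (ltry _).
  have [/= it tle] := MP _ Q'fin.
  apply: (@le_trans _ _ (\int[Q']_w (h w + Num.max (F w - M) 0))%R).
    rewrite -lee_fin /Rintegral !fineK; first last.
    - apply: (integrable_fin_num measurableT).
      exact: good_integrable.
    - apply: (integrable_fin_num measurableT).
      exact: (integrableD measurableT (ih Q') it).
    apply: ae_le_integral; first exact: measurable_int (good_integrable gxi Q'fin).
      exact: measurable_int (integrableD measurableT (ih Q') it).
    apply: acprob_ae; apply: filterS2 kP (good_fval gxi) => w [_ fk] fE.
    move: fk; rewrite fE !lee_fin => fk.
    have FM : (F w - M <= Num.max (F w - M) 0)%R by rewrite le_max lexx.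
    have FM0 : (0 <= Num.max (F w - M) 0)%R by rewrite le_max lexx orbT.
    have := ler_norm k => kk.
    rewrite /h; case: (leP (Num.max (fval xi w) (- N%:R))%R B) => _; last first.
      by rewrite /B; lra.
    have : (fval xi w <= Num.max (fval xi w) (- N%:R))%R by rewrite le_max lexx.
    by lra.
  rewrite (RintegralD measurableT (ih Q') it) lerD2l (le_trans tle)//.
  rewrite mulrAC ler_pdivrMr; last by lra.
  rewrite ler_pM2l// lerD2l -lee_fin (penalty_fineK pgamma Q'fin)//.
have lower : (\int[Q]_w h w <= \int[Q]_w fval xi w + e)%R.
  rewrite (le_trans _ NP)//; apply: (le_Rintegral measurableT (ih Q) iN) => w _.
  by rewrite /h ge_min lexx.
have contQ : nbhs Q [set Q' : acprob P | (\int[Q']_w h w < \int[Q]_w h w + e)%R].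
  have := @Loo_integral_continuous _ _ _ _ zeta Q.
  rewrite zetaE => /cvgr_lt; apply.
  by rewrite ltrDl.
have gQ : ((fine (gamma Q) - e)%:E < gamma Q).
  by rewrite -[ltRHS](penalty_fineK pgamma Qfin) lte_fin ltrBlDr ltrDl.
have [V QV VP] := penalty_lsc pgamma gQ.
apply: filterS2 contQ QV => Q' /= hQ' /VP gQ' Q'c.
have Q'fin : fin_penalty gamma Q' by apply: le_lt_trans Q'c (ltry _).
move: gQ'; rewrite -(penalty_fineK pgamma Q'fin) lte_fin.
have := upper _ Q'c; move: lower hQ'; rewrite /lagrangian.
have : (4 * e = lagrangian eta xi Q - a)%R by rewrite /e; field.
by rewrite /lagrangian; lra.
Qed.

(** The mean of F grows at most like half of the penalty. *)
Lemma lagrangian_coercive eta (a : R) : exists c : R, forall Q,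
  fin_penalty gamma Q -> (c < fine (gamma Q))%R -> (a <= lagrangian eta xi0 Q)%R.
Proof.
have half : (0 < 2^-1 :> R)%R by rewrite invr_gt0.
have [M M0 MP] := F_UI half.
exists (2 * (a - \int[P]_w (xi0 w * eta w) + M + 2^-1))%R => Q Qfin cQ.
have [/= it tle] := MP _ Qfin.
have iM : Q.-integrable setT (EFin \o cst M) by exact: finite_measure_integrable_cst.
have : (\int[Q]_w fval xi0 w <= \int[Q]_w (M + Num.max (F w - M) 0))%R.
  rewrite -lee_fin /Rintegral !fineK; first last.
  - apply: (integrable_fin_num measurableT).
    by apply: good_integrable => //; exact: good_xi0.
  - apply: (integrable_fin_num measurableT).
    exact: (integrableD measurableT iM it).
  apply: ae_le_integral.
    exact: measurable_int (good_integrable good_xi0 Qfin).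
    exact: measurable_int (integrableD measurableT iM it).
  apply: acprob_ae; apply: filterS2 reg (good_fval good_xi0) => w [_ _ fF _] fE.
  move: fF; rewrite fE !lee_fin.
  have : (F w - M <= Num.max (F w - M) 0)%R by rewrite le_max lexx.
  by lra.
rewrite RintegralD// Rintegral_cst//.
have -> : fine (Q setT) = 1%R by have /= -> := probability_setT Q.
rewrite mulr1.
by rewrite /lagrangian; lra.
Qed.

Lemma lagrangian_convexlike eta :
  convexlike (fin_penalty gamma) [set xi : Loo P | good xi] (lagrangian eta).
Proof.
move=> Q1 Q2 t fin1 fin2 t01; have [Q QE] := acprob_mixture Q1 Q2 t01.
have := penalty_convex pgamma t01 QE.
rewrite -(penalty_fineK pgamma fin1) -(penalty_fineK pgamma fin2).
rewrite -!EFinM -EFinD => Qle.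
have Qfin : fin_penalty gamma Q by apply: le_lt_trans Qle (ltry _).
exists Q => // xi /= gxi; rewrite /lagrangian.
have [_ ->] := mixture_integral t01 QE (good_integrable gxi fin1)
  (good_integrable gxi fin2).
by move: Qle; rewrite -(penalty_fineK pgamma Qfin) lee_fin; lra.
Qed.

Lemma lagrangian_concavelike eta :
  concavelike (fin_penalty gamma) [set xi : Loo P | good xi] (lagrangian eta).
Proof.
move=> xi1 xi2 t /= g1 g2 t01; have g := good_convex t01 g1 g2.
have [xi xiE] := good_Loo g; exists xi => [|Q Qfin]; first by rewrite /= xiE.
have [i1 _] := expectation_Loo_L1 xi1 eta.
have [i2 _] := expectation_Loo_L1 xi2 eta.
have j1 := good_integrable g1 Qfin; have j2 := good_integrable g2 Qfin.
have P_lin : (\int[P]_w (xi w * eta w) =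
    t * \int[P]_w (xi1 w * eta w) + (1 - t) * \int[P]_w (xi2 w * eta w))%R.
  rewrite xiE -!RintegralZl// -RintegralD//; first last.
  - by apply: (integrableZl _ (1 - t)%R i2).
  - by apply: (integrableZl _ t i1).
  by apply: eq_Rintegral => w _; ring.
have k1 := integrableZl measurableT t j1.
have k2 := integrableZl measurableT (1 - t)%R j2.
have Q_conv : (\int[Q]_w fval xi w <=
    t * \int[Q]_w fval xi1 w + (1 - t) * \int[Q]_w fval xi2 w)%R.
  rewrite -!RintegralZl// -RintegralD// -lee_fin /Rintegral !fineK; first last.
  - apply: (integrable_fin_num measurableT); rewrite xiE.
    exact: good_integrable.
  - apply: (integrable_fin_num measurableT).
    exact: (integrableD measurableT k1 k2).
  apply: ae_le_integral.
  - by rewrite xiE; exact: measurable_int (good_integrable g Qfin).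
  - exact: measurable_int (integrableD measurableT k1 k2).
  apply: acprob_ae; rewrite xiE.
  apply: filterS3 reg (good_fval g) (filterI (good_fval g1) (good_fval g2)).
  move=> w [cvx _ _ _] E [E1 E2]; rewrite -E.
  by rewrite (le_trans (cvx _ _ _ t01))// E1 E2.
by rewrite /lagrangian P_lin; lra.
Qed.

(** On a compact level of the penalty finitely many good functions keep the
    Lagrangian above a, and beyond that level xi0 does; they merge into one. *)
Lemma Hpen_le_Iconj eta : Hpen f gamma eta <= Iconj f gamma eta.
Proof.
rewrite leNgt; apply/negP => /ereal_between[a Ia aH].
move: Ia; rewrite ltNge => /negP; apply.
have [c cP] := lagrangian_coercive eta a.
pose U xi := [set Q' | gamma Q' <= c%:E -> (a < lagrangian eta xi Q')%R].
have [|vs [vsG vscov]] := @compact_finite_selection _ _ _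
    [set xi : Loo P | good xi] U (@level_compact _ _ _ _ _ pgamma c).
  move=> Q /= Qc; have Qfin : fin_penalty gamma Q by apply: le_lt_trans Qc (ltry _).
  have aHQ : (a - fine (gamma Q))%:E < Hdiv f eta Q.
    rewrite EFinB lteBlDr// (penalty_fineK pgamma Qfin) (lt_le_trans aH)//.
    by apply: ereal_inf_lbound; exists Q.
  have [xi gxi axi] := Hdiv_approx Qfin aHQ.
  exists xi => //; apply: lagrangian_lsc => //.
  by move: axi; rewrite lte_fin /lagrangian; lra.
have [|xi /= gxi xiP] := @finite_alternative _ _ _ (fin_penalty gamma)
  [set xi : Loo P | good xi] (lagrangian eta) xi0 vs a
  (lagrangian_convexlike eta) (lagrangian_concavelike eta) good_xi0 vsG.
  move=> Q Qfin; have [Qc|cQ] := leP (gamma Q) c%:E.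
    have [xi xivs Uxi] := vscov Q Qc.
    by exists xi; [rewrite inE xivs orbT|exact/ltW/Uxi].
  exists xi0; first by rewrite mem_head.
  by apply: cP => //; rewrite -lte_fin (penalty_fineK pgamma Qfin).
have [_ EE] := expectation_Loo_L1 xi eta.
apply: (@le_trans _ _ ('E_P[(xi \* eta)%R] - Ifun f gamma xi)); last first.
  by apply: ereal_sup_ubound; exists xi.
have : Ifun f gamma xi <= (\int[P]_w (xi w * eta w) - a)%:E.
  apply: ge_ereal_sup => _ [Q Qfin <-].
  rewrite (integral_fval (good_fval gxi) (good_integrable gxi Qfin)).
  rewrite -(penalty_fineK pgamma Qfin) -EFinB lee_fin.
  by have := xiP _ Qfin; rewrite /lagrangian; lra.
rewrite EE; case: (Ifun f gamma xi) => [r||]//=; rewrite ?leey// !lee_fin.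
by lra.
Qed.

(** * Semicontinuity and biduality *)

Lemma Iconj_weakly_lsc :
  lower_semicontinuous (Iconj f gamma : weakL1 P -> \bar R).
Proof.
move=> eta a /ereal_sup_gt[_ [xi _ <-]] aE.
exists [set eta' : weakL1 P | a%:E < 'E_P[(xi \* (eta' : L1 P))%R] - Ifun f gamma xi].
  move: aE; rewrite /=.
  have EE (eta' : L1 P) : 'E_P[(xi \* eta')%R] = (pairing eta' xi)%:E.
    by rewrite /pairing; have [_ ->] := expectation_Loo_L1 xi eta'.
  rewrite EE; case: (Ifun f gamma xi) => [r||]//= aE.
    have : nbhs (eta : weakL1 P) [set eta' : weakL1 P | (a + r < pairing eta' xi)%R].
      have /cvgr_gt := @pairing_continuous _ _ _ P xi eta; apply.
      by move: aE; rewrite lte_fin; lra.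
    by apply: filterS => eta' /= ar; rewrite EE lte_fin; lra.
  by apply: filterS filterT => eta' _; rewrite /= EE ltry.
by move=> eta' /= ae; rewrite (lt_le_trans ae)//; apply: ereal_sup_ubound; exists xi.
Qed.

Definition cval y w : R := fine (conjugate f w (y w)).

Lemma conjugate_measurable y : measurable_fun setT y ->
  measurable_fun setT (fun w => conjugate f w (y w)).
Proof.
move=> my; under eq_fun do rewrite conjugate_persp.
by apply: persp_measurable => //; apply: aeW => w; exact: ler01.
Qed.

Lemma conjugate_lower w v : regular w ->
  (xi0 w * v - F w)%:E <= conjugate f w v.
Proof.
move=> [_ _ fF _]; apply: le_trans (conjugate_ge f w (xi0 w) v).
by rewrite EFinB leeB.
Qed.

Lemma cval_integrable y (h : T -> R) Q : measurable_fun setT y ->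
  fin_penalty gamma Q -> Q.-integrable setT (EFin \o y) ->
  Q.-integrable setT (EFin \o h) ->
  {ae P, forall w, conjugate f w (y w) <= (h w)%:E} ->
  Q.-integrable setT (EFin \o cval y).
Proof.
move=> my Qfin iy ih ch; have [k k0 xk] := Loo_ae_bounded xi0.
have iF := F_int Qfin.
apply: (@ae_integrableP _ _ _ _ _ (fun w => (k * `|y w| + F w) + `|h w|)%R).
- by apply: measurableT_comp => //; exact: conjugate_measurable.
- apply: acprob_ae; apply: filterS3 reg xk ch => w rw xk ch.
  have := conjugate_lower (y w) rw; rewrite /cval.
  case: (conjugate f w (y w)) ch => [r||]//=; rewrite !lee_fin => rh lr.
  have : (`|xi0 w * y w| <= k * `|y w|)%R by rewrite normrM ler_wpM2r.
  have := ler_norm (- (xi0 w * y w))%R; rewrite normrN.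
  have := ler_norm (h w); have := F_ge0 w; have := normr_ge0 (h w).
  have := mulr_ge0 k0 (normr_ge0 (y w)).
  by move=> *; rewrite ler_norml; apply/andP; split; lra.
have -> : EFin \o (fun w => (k * `|y w| + F w) + `|h w|)%R =
    ((fun w => k%:E * (EFin \o (fun w => `|y w|%R)) w) \+ (EFin \o F)) \+
    (EFin \o (fun w => `|h w|%R)) by [].
apply: integrableD => //; last exact: integrable_norm.
apply: integrableD => //.
by apply: integrableZl => //; exact: integrable_norm.
Qed.

Lemma Loo_mul_integrable xi y Q : measurable_fun setT y ->
  Q.-integrable setT (EFin \o y) ->
  Q.-integrable setT (EFin \o (fun w => xi w * y w)%R).
Proof.
move=> my iy; have [k k0 xk] := Loo_ae_bounded xi.
apply: (@ae_integrableP _ _ _ _ _ (fun w => k * `|y w|)%R).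
- exact: measurable_funM.
- by have := acprob_ae Q xk; apply: filterS => w /= xkw; rewrite normrM ler_wpM2r.
have -> : EFin \o (fun w => k * `|y w|)%R =
  (fun w => k%:E * (EFin \o (fun w => `|y w|%R)) w) by [].
by apply: integrableZl => //; exact: integrable_norm.
Qed.

(** The perspective conjugate is positively homogeneous: at (y z, z) it is z
    times the conjugate at y. *)
Lemma Hdiv_density_le y Q eta : measurable_fun setT y ->
  {ae P, forall w, conjugate f w (y w) = (cval y w)%:E} ->
  Q.-integrable setT (EFin \o cval y) ->
  (forall w, eta w = (y w * density Q w)%R) ->
  Hdiv f eta Q <= (\int[Q]_w cval y w)%:E.
Proof.
move=> my yE iy etaE; have [iP eP] := density_integrable iy.
rewrite /Rintegral -eP fineK ?integrable_fin_num//.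
apply: ae_le_integral; [|exact: measurable_int iP|].
  exact: persp_measurable (density_ge0 Q).
apply: filterS2 yE (density_ge0 Q) => w yE d0.
apply: ge_ereal_sup => _ [x /= fx <-].
have [r fr] := fin_of_lty (fNy w) fx.
have := conjugate_ge f w x (y w); rewrite yE fr -!EFinM -!EFinB !lee_fin etaE => le.
by have := ler_wpM2l d0 le; rewrite /=; lra.
Qed.

(** The interchange for f(xi), seen as the conjugate of f^*, under Q: the
    candidates are now built from eta0, and y is turned into the dual element
    y dQ/dP. *)
Lemma dual_attainment xi Q (a : \bar R) : fin_penalty gamma Q ->
  a < \int[Q]_w f w (xi w) ->
  exists eta, a < 'E_P[(xi \* eta)%R] - Hdiv f eta Q.
Proof.
move=> Qfin aI.
pose D := [set y : T -> R | [/\ measurable_fun setT y,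
  Q.-integrable setT (EFin \o y), Q.-integrable setT (EFin \o cval y) &
  {ae P, forall w, conjugate f w (y w) = (cval y w)%:E}]].
have cNy w v : regular w -> -oo < conjugate f w v.
  by move=> rw; rewrite (lt_le_trans _ (conjugate_lower v rw))// ltNyr.
have Dpaste v z (b : T -> bool) : measurable_fun setT b -> D v -> D z ->
    D (fun w => if b w then v w else z w).
  move=> mb [mv iv icv vE] [mz iz icz zE].
  have split_int (g1 g2 : T -> R) : measurable_fun setT g1 ->
      measurable_fun setT g2 -> Q.-integrable setT (EFin \o g1) ->
      Q.-integrable setT (EFin \o g2) ->
      Q.-integrable setT (EFin \o (fun w => if b w then g1 w else g2 w)).
    move=> m1 m2 i1 i2.
    apply: (@ae_integrableP _ _ _ _ _ (fun w => `|g1 w| + `|g2 w|)%R).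
    - exact: measurable_fun_ifT.
    - by apply: aeW => w; case: (b w); rewrite ?lerDl ?lerDr.
    have -> : EFin \o (fun w => `|g1 w| + `|g2 w|)%R =
      (EFin \o (fun w => `|g1 w|%R)) \+ (EFin \o (fun w => `|g2 w|%R)) by [].
    by apply: integrableD => //; exact: integrable_norm.
  have mc (v' : T -> R) : measurable_fun setT v' -> measurable_fun setT (cval v').
    by move=> mv'; apply: measurableT_comp => //; exact: conjugate_measurable.
  have cE : cval (fun w => if b w then v w else z w) =
      (fun w => if b w then cval v w else cval z w).
    by apply/funext => w; rewrite /cval; case: (b w).
  split; first exact: measurable_fun_ifT.
  - exact: split_int.
  - by rewrite cE; apply: split_int => //; exact: mc.
  - rewrite cE; apply: filterS2 vE zE => w vE zE.
    by case: (b w).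
have mconj q : measurable_fun setT (fun w => conjugate f w (ratr q)).
  by apply: (@conjugate_measurable (fun=> ratr q)).
have Dcand n : D (candidate (conjugate f) eta0 n).
  have mc : measurable_fun setT (candidate (conjugate f) eta0 n).
    exact: candidate_measurable.
  have [q [k candE]] := candidateP (conjugate f) eta0 n.
  have ic : Q.-integrable setT (EFin \o candidate (conjugate f) eta0 n).
    apply: (@ae_integrableP _ _ _ _ _ (fun w => `|eta0 w| + `|q|)%R) => //.
      by apply: aeW => w; have [->|[-> _]] := candE w; rewrite ?lerDl ?lerDr.
    have -> : EFin \o (fun w => `|eta0 w| + `|q|)%R =
      (EFin \o (fun w => `|eta0 w|%R)) \+ (EFin \o cst `|q|%R) by [].
    apply: integrableD => //; last exact: finite_measure_integrable_cst.
    by apply: integrable_norm => //; exact: eta0_int.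
  have cb : {ae P, forall w, conjugate f w (candidate (conjugate f) eta0 n w) <=
      (`|u w| + k%:R)%:E}.
    apply: filterS reg => w [_ _ _ cu].
    have un := ler_norm (u w); have k0 := ler0n R k; have u0 := normr_ge0 (u w).
    have [->|[-> ck]] := candE w.
      by rewrite (le_trans cu)// lee_fin; lra.
    by rewrite (le_trans ck)// lee_fin; lra.
  split => //.
  - apply: (cval_integrable mc Qfin ic _ cb).
    have -> : EFin \o (fun w => `|u w| + k%:R)%R =
      (EFin \o (fun w => `|u w|%R)) \+ (EFin \o cst k%:R) by [].
    apply: integrableD => //; last exact: finite_measure_integrable_cst.
    by apply: integrable_norm => //; exact: u_int.
  - apply: filterS2 reg cb => w rw cb; rewrite /cval.
    have := cNy w (candidate (conjugate f) eta0 n w) rw.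
    by case: (conjugate f w _) cb.
have Vint y : D y ->
    Q.-integrable setT (EFin \o (fun w => y w * xi w - 1 * cval y w)%R).
  move=> [my iy icy _].
  have -> : EFin \o (fun w => y w * xi w - 1 * cval y w)%R =
      (EFin \o (fun w => xi w * y w)%R) \- (EFin \o cval y).
    by apply/funext => w; rewrite /= mul1r mulrC.
  by apply: integrableB => //; exact: Loo_mul_integrable.
have [||y Dy ay] := @interchange_sup _ _ _ Q
  (fun w v => v * xi w - 1 * fine (conjugate f w v))%R D
  (candidate (conjugate f) eta0) _ a Dpaste Dcand Vint _ _ aI.
- exact: integrand_measurableT.
- apply: acprob_ae; apply: filterS reg => w rw; have [cvx lsc fF cu] := rw.
  rewrite -(biconjugate _ cvx (fNy w) lsc cu).
  apply: (candidate_sup _ (@conjugate_econvex _ _ _ f w)) => //.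
  - by move=> v; exact: cNy.
  - exact: le_lt_trans cu (ltry _).
have [my iy icy yE] := Dy.
have [iP _] := density_integrable iy.
have etaL : (fun w => y w * density Q w)%R \in Lfun P 1.
  by apply/Lfun1_integrable.
pose eta : L1 P := Lfun_Sub (lexx (1 : \bar R)) etaL.
exists eta; rewrite (lt_le_trans ay)//.
have ixy := Loo_mul_integrable xi my iy.
have -> : 'E_P[(xi \* eta)%R] = \int[Q]_w (xi w * y w)%:E.
  have [_ <-] := density_integrable ixy.
  rewrite unlock; apply: eq_integral => w _ /=.
  by rewrite mulrA.
apply: (@le_trans _ _ (\int[Q]_w (xi w * y w)%:E - \int[Q]_w (cval y w)%:E)).
  rewrite -integralB// le_eqVlt; apply/orP; left; apply/eqP.
  by apply: eq_integral => w _; rewrite /= -EFinB mul1r (mulrC (y w)).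
rewrite leeB//.
have := @Hdiv_density_le y Q eta my yE icy (fun=> erefl).
by rewrite /Rintegral fineK// integrable_fin_num.
Qed.

Lemma Ifun_biconjugate xi : Ifun f gamma xi =
  ereal_sup [set 'E_P[(xi \* eta)%R] - Hpen f gamma eta | eta in [set: L1 P]].
Proof.
apply/eqP; rewrite eq_le; apply/andP; split; last first.
  apply: ge_ereal_sup => _ [eta _ <-].
  have : 'E_P[(xi \* eta)%R] - Ifun f gamma xi <= Hpen f gamma eta.
    by apply: le_trans (Iconj_le_Hpen eta); apply: ereal_sup_ubound; exists xi.
  have [_ ->] := expectation_Loo_L1 xi eta.
  case: (Ifun f gamma xi) => [r||]; rewrite ?leey//.
    case: (Hpen f gamma eta) => [s||]//=; rewrite ?leNye// -!EFinB !lee_fin.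
    by lra.
  by rewrite /= leye_eq => /eqP ->.
apply: ge_ereal_sup => _ [Q Qfin <-]; rewrite leNgt; apply/negP.
move=> /ereal_between[a sa aI].
have aI' : a%:E + gamma Q < \int[Q]_w f w (xi w).
  by rewrite -lteBrDr// -(penalty_fineK pgamma Qfin).
have [eta aeta] := dual_attainment Qfin aI'.
move: sa; rewrite ltNge => /negP; apply.
apply: (@le_trans _ _ ('E_P[(xi \* eta)%R] - Hpen f gamma eta)); last first.
  by apply: ereal_sup_ubound; exists eta.
have : Hpen f gamma eta <= Hdiv f eta Q + gamma Q.
  by apply: ereal_inf_lbound; exists Q.
move: aeta; have [_ ->] := expectation_Loo_L1 xi eta.
rewrite -(penalty_fineK pgamma Qfin).
case: (Hdiv f eta Q) => [r||]//=.
  case: (Hpen f gamma eta) => [s||]//=; rewrite ?leey//.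
  by rewrite -!EFinB -!EFinD lte_fin !lee_fin; lra.
by case: (Hpen f gamma eta) => [s||]//=; rewrite ?leey.
Qed.

End duality.

(** * The theorem *)

Theorem corollary3p2 (d : measure_display) (T : measurableType d)
    (R : realType) (P : probability T R) (completeP : measure_is_complete P)
    (gamma : acprob P -> \bar R) (penalty_gamma : penalty gamma)
    (f : T -> R -> \bar R) (normal_f : normal_convex_integrand P f)
    (eta0_ex : exists eta0 : T -> R, Lrho gamma (EFin \o eta0) /\
       Lrho gamma (fun w => conjugate f w (eta0 w))^\+)
    (xi0_ex : exists xi0 : Loo P, Mrhou gamma (fun w => f w (xi0 w))^\+) :
  [/\ forall eta : L1 P,
        Iconj f gamma eta = Hpen f gamma eta /\
        Hpen f gamma eta =
          ereal_inf [set Hdiv f eta Q + gamma Q | Q in fin_penalty gamma],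
      lower_semicontinuous (Hpen f gamma : weakL1 P -> \bar R)
    & forall xi : Loo P,
        Ifun f gamma xi =
          ereal_sup [set 'E_P[(xi \* eta)%R] - Hpen f gamma eta
                    | eta in [set: L1 P]] ].
Proof.
have [eta0 [Leta0 Lconj]] := eta0_ex; have [xi0 Mxi0] := xi0_ex.
pose F w := fine ((fun w => f w (xi0 w))^\+ w).
pose u w := fine ((fun w => conjugate f w (eta0 w))^\+ w).
have fine_max (h : T -> \bar R) w : h^\+ w \is a fin_num ->
    h w <= (fine (h^\+ w))%:E.
  by move=> /fineK ->; rewrite funeposE le_max lexx.
have reg : {ae P, forall w, regular f F u eta0 xi0 w}.
  have [[[_ uae] _] [[_ Fae] _]] := (Lconj, Mxi0).
  apply: filterS2 (filterI (integrand_convex normal_f) (integrand_lsc normal_f))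
    (filterI uae Fae) => w [cvx lsc] [ufin Ffin].
  split => //; first exact: (fine_max (fun w => f w (xi0 w))).
  exact: (fine_max (fun w => conjugate f w (eta0 w))).
have F0 w : (0 <= F w)%R by rewrite fine_ge0// funepos_ge0.
have meta0 : measurable_fun setT eta0.
  by have [[/measurable_EFinP]] := Leta0.
have eta0i Q : fin_penalty gamma Q -> Q.-integrable setT (EFin \o eta0).
  exact: (Lrho_integrable penalty_gamma Leta0).
have ui Q : fin_penalty gamma Q -> Q.-integrable setT (EFin \o u).
  move=> Qfin; have i := Lrho_integrable penalty_gamma Lconj Qfin.
  apply: (le_integrable _ _ _ i) => //.
    by apply/measurable_EFinP; apply: measurableT_comp => //; exact: measurable_int i.
  by move=> w _; rewrite /= /u; case: (_^\+ w) => [r||]//=; rewrite leey.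
have FUI (e : R) : (0 < e)%R -> _ :=
  @Mrhou_uniform_integrability _ _ _ P gamma penalty_gamma _ e Mxi0.
have mF : measurable_fun setT F.
  by have [[mf _] _] := Mxi0; apply: measurableT_comp.
have IH eta : Iconj f gamma eta = Hpen f gamma eta.
  by apply/eqP; rewrite eq_le (Iconj_le_Hpen completeP penalty_gamma normal_f reg)
    // (Hpen_le_Iconj completeP penalty_gamma normal_f reg).
split => [//||xi].
  have -> : Hpen f gamma = Iconj f gamma by apply/funext => eta; rewrite IH.
  exact: Iconj_weakly_lsc.
exact: (Ifun_biconjugate completeP penalty_gamma normal_f reg).
Qed.
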